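(* Let $n \ge 4$, let $\mathbb{F}$ be the free group of rank $n$, and let $\mathcal{F}$ be the free factor complex of $\mathbb{F}$. Put $C = 2n-4$. There exists a family of loops $c_N$, for $N \in \mathbb{N}$, each of combinatorial length $4$ in the $1$-skeleton $\mathcal{F}^{(1)}$, such that the following holds for every $N$: whenever $P$ is a triangulation of a disc and $f\colon P \to \mathcal{F}^{(2)}$ is a simplicial map to the $2$-skeleton with $f|_{\partial P}$ mapping bijectively onto $c_N$, then $P$ must have at least $(N-2C)/3$ triangles ($2$-simplices).
   Context: The free factor complex $\mathcal{F}$ associated to a free group $\mathbb{F}$ is the simplicial complex whose vertices are conjugacy classes of proper non-trivial free factors of $\mathbb{F}$, and in which a collection $\{[A_1],\ldots,[A_k]\}$ of vertices spans a simplex if (after reordering) $A_1 \subset A_2 \subset \cdots \subset A_k$, where the inclusions are up to conjugation. $K^{(i)}$ denotes the $i$-skeleton of a simplicial complex $K$. A simplicial map $c\colon P \to K$ between simplicial complexes is a map sending each simplex of $P$ to a simplex of $K$ by a linear map taking vertices to vertices. A combinatorial loop in $K$ is a sequence of vertices $(v_1,\ldots,v_k)$ of $K$ such that $v_i$ is adjacent (or equal) to $v_{i+1}$ for $1\le i\le k-1$ and $v_k$ is adjacent (or equal) to $v_1$; its combinatorial length is $k$. Equivalently, it is a simplicial map to $K$ from a triangulation of $S^1$ with $k$ edges. *)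

(* Defs.v *)
From HB Require Import structures.
From mathcomp Require Import all_boot all_order all_algebra.
From mathcomp Require Import finmap.
From mathcomp Require Import all_classical all_reals all_analysis.

Set Implicit Arguments.
Unset Strict Implicit.
Unset Printing Implicit Defensive.

Import Order.TTheory GRing.Theory Num.Theory.
Import numFieldNormedType.Exports.

Local Open Scope classical_set_scope.
Local Open Scope card_scope.

(* Abstract simplicial complexes; the vertices are the v with [set v] a
   simplex, so V may contain elements that are not vertices. *)
Record scomplex (V : Type) := SComplex {
  simplices :> set V -> Prop ;
  simplex_finite : forall s, simplices s -> finite_set s ;
  simplex_neq0 : forall s, simplices s -> s !=set0 ;
  simplex_sub : forall s t, simplices s -> t `<=` s -> t !=set0 ->
    simplices t }.

Section Complexes.
Variable V : Type.
Implicit Types K : scomplex V.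

Definition dim_simplices K (i : nat) : set (set V) :=
  [set s | K s /\ s #= `I_(i.+1)].

Definition skeleton_simplices K (i : nat) : set (set V) :=
  [set s | K s /\ s #<= `I_(i.+1)].

Lemma skeleton_finite K i s : skeleton_simplices K i s -> finite_set s.
Proof. by case=> /simplex_finite. Qed.

Lemma skeleton_neq0 K i s : skeleton_simplices K i s -> s !=set0.
Proof. by case=> /simplex_neq0. Qed.

Lemma skeleton_sub K i s t : skeleton_simplices K i s -> t `<=` s ->
  t !=set0 -> skeleton_simplices K i t.
Proof.
move=> [Ks si] ts t0; split; first exact: simplex_sub Ks ts t0.
exact: card_le_trans (subset_card_le ts) si.
Qed.

Definition skeleton K (i : nat) : scomplex V :=
  SComplex (@skeleton_finite K i) (@skeleton_neq0 K i) (@skeleton_sub K i).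

(* As [set v; v] = [set v], this says that cyclically consecutive vertices are
   adjacent or equal (ordS is the cyclic successor). *)
Definition comb_loop K (k : nat) (c : 'I_k -> V) : Prop :=
  forall i, K [set c i; c (ordS i)].

Definition loop_simplices (k : nat) (c : 'I_k -> V) : set (set V) :=
  [set s | exists i, s = [set c i] \/ s = [set c i; c (ordS i)]].

End Complexes.

(* A simplicial map is determined by its effect f on vertices. *)
Definition simplicial_map (V W : Type) (P : scomplex V) (K : scomplex W)
    (f : V -> W) : Prop :=
  forall s, P s -> K (f @` s).

Section Disc.
Variable R : realType.
Local Open Scope ring_scope.

Definition support (m : nat) (x : 'rV[R]_m) : set 'I_m :=
  [set i | x ord0 i != 0].

(* Barycentric coordinates. *)
Definition realization (m : nat) (P : scomplex 'I_m) : set 'rV[R]_m :=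
  [set x : 'rV[R]_m | [/\ forall i, 0 <= x ord0 i,
               \sum_i x ord0 i = 1 &
               P (support x)]].

Definition closed_simplex (m : nat) (s : set 'I_m) : set 'rV[R]_m :=
  [set x : 'rV[R]_m | [/\ forall i, 0 <= x ord0 i,
               \sum_i x ord0 i = 1 &
               support x `<=` s]].

Definition homeomorphism_on (T U : topologicalType) (A : set T) (B : set U)
    (h : T -> U) : Prop :=
  [/\ set_bij A B h, {within A, continuous h} &
      exists2 g : U -> T, {in A, cancel h g} & {within B, continuous g}].

(* Written out with coordinates: the library norm on R * R is the sup norm. *)
Definition unit_disc : set (R * R) := [set z | z.1 ^+ 2 + z.2 ^+ 2 <= 1].
Definition unit_circle : set (R * R) := [set z | z.1 ^+ 2 + z.2 ^+ 2 = 1].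

(* A triangulation of the disc is a finite complex P together with a
   homeomorphism h from its realization. *)
Definition disc_triangulation (m : nat) (P : scomplex 'I_m)
    (h : 'rV[R]_m -> R * R) : Prop :=
  homeomorphism_on (realization P) unit_disc h.

Definition boundary_simplices (m : nat) (P : scomplex 'I_m)
    (h : 'rV[R]_m -> R * R) : set (set 'I_m) :=
  [set s | P s /\ h @` closed_simplex s `<=` unit_circle].

End Disc.

Definition num_triangles (m : nat) (P : scomplex 'I_m) : nat :=
  #|` fset_set (dim_simplices P 2)|%N.

Section Groups.
Local Open Scope group_scope.

Definition free_basis (G : groupType) (I : Type) (x : I -> G) : Prop :=
  forall (H : groupType) (y : I -> H),
    exists! phi : G -> H, monoid.monoid_morphism phi /\ forall i, phi (x i) = y i.

Variable G : groupType.
Implicit Types A B : set G.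

Definition subgroup A : Prop :=
  [/\ A 1, forall x y, A x -> A y -> A (x * y) & forall x, A x -> A x^-1].

Definition hom_on (H : groupType) A (f : G -> H) : Prop :=
  forall x y, A x -> A y -> f (x * y) = f x * f y.

(* G is the internal free product A * B (coproduct of groups). *)
Definition is_free_product A B : Prop :=
  forall (H : groupType) (alpha beta : G -> H),
    hom_on A alpha -> hom_on B beta ->
    exists! phi : G -> H, [/\ monoid.monoid_morphism phi,
      forall a, A a -> phi a = alpha a & forall b, B b -> phi b = beta b].

Definition free_factor A : Prop :=
  subgroup A /\ exists2 B, subgroup B & is_free_product A B.

Definition proper_free_factor A : Prop :=
  [/\ free_factor A, A <> [set 1] & A <> setT].

Definition conj_set A (g : G) : set G := [set a ^ g | a in A].

Definition conj_class A : set (set G) := range (conj_set A).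

Definition sub_up_to_conj A B : Prop := exists g, A `<=` conj_set B g.

(* Sets of the form {[A_0], ..., [A_(k-1)]} with each A_i contained in a
   conjugate of A_(i+1); repetitions among the classes [A_i] are harmless. *)
Definition ff_simplices : set (set (set (set G))) :=
  [set s | exists k (A : nat -> set G),
    [/\ (0 < k)%N,
        forall i, (i < k)%N -> proper_free_factor (A i),
        forall i, (i.+1 < k)%N -> sub_up_to_conj (A i) (A i.+1) &
        s = [set conj_class (A i) | i in `I_k]]].

Lemma ff_finite s : ff_simplices s -> finite_set s.
Proof. by move=> [k [A [_ _ _ ->]]]; exact: finite_image. Qed.

Lemma ff_neq0 s : ff_simplices s -> s !=set0.
Proof. by move=> [k [A [k0 _ _ ->]]]; exists (conj_class (A 0%N)), 0%N. Qed.

Lemma sub_up_to_conj_refl A : sub_up_to_conj A A.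
Proof. by exists 1 => a Aa; exists a => //; rewrite conjg1. Qed.

Lemma sub_up_to_conj_trans A B C :
  sub_up_to_conj A B -> sub_up_to_conj B C -> sub_up_to_conj A C.
Proof.
move=> [g AB] [g' BC]; exists (g' * g) => a /AB [b /BC [c Cc <-] <-].
by exists c => //; rewrite conjgM.
Qed.

Lemma ff_sub s t : ff_simplices s -> t `<=` s -> t !=set0 -> ff_simplices t.
Proof.
move=> [k [A [k0 Aff Ach ->]]] ts [v tv].
have Amono i j : (i <= j)%N -> (j < k)%N -> sub_up_to_conj (A i) (A j).
  elim: j => [|j IHj]; first by rewrite leqn0 => /eqP -> _; exact: sub_up_to_conj_refl.
  rewrite leq_eqVlt => /orP[/eqP -> _|ij jk]; first exact: sub_up_to_conj_refl.
  by apply: sub_up_to_conj_trans (Ach _ jk); apply: IHj => //; exact: ltnW.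
pose l := [seq i <- iota 0 k | `[< t (conj_class (A i)) >]].
have lP i : i \in l <-> (i < k)%N /\ t (conj_class (A i)).
  rewrite mem_filter mem_iota add0n leq0n /=.
  by split=> [/andP[/asboolP ? ?]|[? ?]] //; apply/andP; split=> //; exact/asboolP.
have lsorted : sorted leq l.
  by apply: sorted_filter; [exact: leq_trans|exact: iota_sorted].
exists (size l), (fun i => A (nth 0%N l i)); split.
- have [i ik iv] := ts _ tv.
  rewrite lt0n size_eq0; apply/negP => /eqP l0.
  have : i \in l by apply/lP; split=> //; rewrite iv.
  by rewrite l0.
- by move=> i il; have /lP[? _] := mem_nth 0%N il; exact: Aff.
- move=> i il; have /lP[? _] := mem_nth 0%N il; apply: Amono => //.
  by apply: (sorted_leq_nth leq_trans leqnn) => //; rewrite inE //= ltnW.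
- rewrite eqEsubset; split=> [w tw|w [i il <-]].
    have [i ik iw] := ts _ tw.
    have il : i \in l by apply/lP; split=> //; rewrite iw.
    by exists (index i l); rewrite /= ?index_mem ?nth_index.
  by have /lP[_] := mem_nth 0%N il.
Qed.

Definition free_factor_complex : scomplex (set (set G)) :=
  SComplex ff_finite ff_neq0 ff_sub.

End Groups.

(* Main.v *)
Require Import Defs.
From HB Require Import structures.
From mathcomp Require Import all_boot all_order all_algebra perm zify lra ring.
From mathcomp Require Import finmap.
From mathcomp Require Import all_classical all_reals all_analysis.

(** Let a and b be the first two basis elements, and let sigma be the
    retraction of F that kills a and fixes the other basis elements.  The loop
    number N runs through the classes of <a>, <a, b>, <b> and <a, b^g>, where
    g = u^(N+2) for a fixed word u in the basis elements other than a.  Its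
    fillings are large because the two neighbours of [<a>] on it are at
    distance at least N in the link of [<a>], and every filling contains a path
    joining them in that link.

    The path.  Let f map a triangulated disc P to the complex, let S be the set
    of vertices sent to [<a>], and join two vertices outside S when they span a
    simplex with some vertex of S.  The two boundary neighbours of the vertex
    over [<a>] lie in one component of this graph.  Otherwise label S by 0, the
    component of the first neighbour by 1, everything else by 2: no simplex
    carries all three labels, yet the boundary runs once around the cycle of
    labels, so it would be a loop of nonzero winding number that contracts in
    the disc ([rainbow], in the spirit of the lemma of Sperner).  A simple path
    in the graph uses a new triangle at each step, so its length bounds the
    number of triangles from below ([link_path]).

    The distance.  The images of the vertices of such a path can be represented
    by proper free factors W_0 = <a, b>, ..., W_l = <a, b^g> that all contain a,
    with consecutive ones nested ([located_step]); the representatives are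
    unambiguous because a free factor that contains a and a^h contains h
    ([factor_malnormal]).  For a proper free factor Z containing a, the
    splitting F = Z * Y yields a 2-colouring of sigma(F), constant on the cosets
    of sigma(Z), taking both values, and changing along only finitely many edges
    of the Cayley tree ([coloring]).  Looking at an outermost vertex of the tree
    where both colours persist, one finds, as in the cut vertex lemma of
    Whitehead, two letters y1 and y2 such that no coset of sigma(Z) contains
    both long words ending in y1 and long words ending in y2 ([missed_turn]).
    The word u is chosen to contain every reduced word of length two, hence the
    turn missed by Z: if the long words of sigma(W_i) never end in u^j, then
    those of sigma(W_(i+1)) never end in u^(j+1) ([avoids_step]).  Long words of
    sigma(W_0), powers of b, do not end in u, whereas g^-1 b^k g ends in
    u^(N+2); hence l >= N+2 ([link_distance]). *)

Set Implicit Arguments.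
Unset Strict Implicit.
Unset Printing Implicit Defensive.

Local Open Scope classical_set_scope.
Local Open Scope group_scope.

(** * Homomorphisms and generation *)

Notation homm := monoid.monoid_morphism.

Section Bijections.
Variable T : Type.

(** The permutations of an arbitrary, possibly infinite, type; actions of F are
    homomorphisms to their group. *)
Record bijection := Bijection {
  bij_fun :> T -> T ;
  bij_inv : T -> T ;
  bij_funK : cancel bij_fun bij_inv ;
  bij_invK : cancel bij_inv bij_fun }.

Lemma bijectionP (s t : bijection) : (forall x, s x = t x) -> s = t.
Proof.
case: s t => [f g fK gK] [f' g' f'K g'K] /= /funext ff'.
rewrite {}ff' in fK gK *.
have gg' : g = g' by apply/funext => x; rewrite -{1}(g'K x) fK.
rewrite {}gg' in fK gK *.
by congr Bijection; exact: Prop_irrelevance.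
Qed.

HB.instance Definition _ := gen_eqMixin bijection.
HB.instance Definition _ := gen_choiceMixin bijection.

Definition bij_one : bijection :=
  @Bijection id id (fun=> erefl) (fun=> erefl).
Definition bij_mul (s t : bijection) : bijection :=
  Bijection (can_comp (bij_funK s) (bij_funK t))
            (can_comp (bij_invK t) (bij_invK s)).
Definition bij_V (s : bijection) : bijection :=
  Bijection (bij_invK s) (bij_funK s).

Lemma bij_mulA : associative bij_mul.
Proof. by move=> s t u; apply: bijectionP. Qed.
Lemma bij_mul1 : left_id bij_one bij_mul.
Proof. by move=> s; apply: bijectionP. Qed.
Lemma bij_mulr1 : right_id bij_one bij_mul.
Proof. by move=> s; apply: bijectionP. Qed.
Lemma bij_mulV : left_inverse bij_one bij_V bij_mul.
Proof. by move=> s; apply: bijectionP => x; exact: bij_funK. Qed.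
Lemma bij_mulrV : right_inverse bij_one bij_V bij_mul.
Proof. by move=> s; apply: bijectionP => x; exact: bij_invK. Qed.

HB.instance Definition _ := isGroup.Build bijection
  bij_mulA bij_mul1 bij_mulr1 bij_mulV bij_mulrV.

Lemma bijM (s t : bijection) x : (s * t) x = s (t x). Proof. by []. Qed.
Lemma bij1 x : (1 : bijection) x = x. Proof. by []. Qed.

End Bijections.

Section Homomorphisms.
Variables G H : groupType.
Implicit Types f g : G -> H.

Lemma homm1 f : homm f -> f 1 = 1. Proof. by case. Qed.
Lemma hommM f : homm f -> {morph f : x y / x * y}. Proof. by case. Qed.
Lemma hommV f x : homm f -> f x^-1 = (f x)^-1.
Proof.
move=> hf; apply: (@mulgI _ (f x)).
by rewrite -(hommM hf) !mulgV homm1.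
Qed.
Lemma hommX f x k : homm f -> f (x ^+ k) = f x ^+ k.
Proof.
move=> hf; elim: k => [|k IH]; first by rewrite !expg0 homm1.
by rewrite !expgS hommM // IH.
Qed.
Lemma homm_comp (K : groupType) (h : H -> K) f :
  homm h -> homm f -> homm (h \o f).
Proof. by move=> hh hf; split=> [|x y] /=; [rewrite hf.1 hh.1|rewrite hf.2 hh.2]. Qed.
Lemma homm_id : homm (@id G). Proof. by split. Qed.
Lemma homm_cst : homm (fun _ : G => (1 : H)).
Proof. by split=> // x y; rewrite mulg1. Qed.

Lemma homm_conj f (t : H) : homm f -> homm (fun x => t * f x * t^-1).
Proof.
move=> hf; split=> [|x y]; first by rewrite homm1 // mulg1 mulgV.
by rewrite hommM // !mulgA mulgVK.
Qed.

Lemma equalizer_subgroup f g : homm f -> homm g ->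
  subgroup [set x | f x = g x].
Proof.
move=> hf hg; split=> /= [|x y fx fy|x fx]; first by rewrite !homm1.
  by rewrite !hommM // fx fy.
by rewrite !hommV // fx.
Qed.
End Homomorphisms.

Section Epimorphisms.
Variable G : groupType.
Implicit Types K : set G.

Definition translate (g : G) : bijection (set G).
Proof.
apply: (@Bijection _ (fun A : set G => [set h | A (g^-1 * h)])
                    (fun A : set G => [set h | A (g * h)])).
- by move=> A; apply/funext => h /=; rewrite mulKg.
- by move=> A; apply/funext => h /=; rewrite mulVKg.
Defined.

Lemma translate_hom : homm translate.
Proof.
split=> [|g h]; apply: bijectionP => A; apply/funext => x /=.
  by rewrite invg1 mul1g.
by rewrite invgM mulgA.
Qed.

Definition swap_set (K : set G) (A : set G) : set G :=
  if `[< A = K >] then set0 else if `[< A = set0 >] then K else A.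

Lemma swap_setK K : K 1 -> involutive (swap_set K).
Proof.
move=> K1 A; rewrite /swap_set.
have K0 : K <> set0 by move=> K0; rewrite K0 in K1.
case: (asboolP (A = K)) => [->|AK].
  by case: asboolP => [/esym//|_]; rewrite asboolT.
case: (asboolP (A = set0)) => [->|A0]; first by rewrite asboolT.
by rewrite asboolF // asboolF.
Qed.

(** Epimorphisms of groups are surjective: compare the translation action on
    subsets with its conjugate by the swap of K and the empty set.  The two
    agree on K, while an element fixing the empty set in the second action
    stabilizes K.  This turns the uniqueness clauses of the universal properties
    into induction principles. *)
Lemma epi_full K : subgroup K ->
  (forall (H : groupType) (f g : G -> H), homm f -> homm g ->
     (forall k, K k -> f k = g k) -> forall x, f x = g x) ->
  forall x, K x.
Proof.
move=> [K1 KM KV] epi x.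
pose tau := Bijection (swap_setK K1) (swap_setK K1).
have tauV : tau^-1 = tau :> bijection (set G) by apply: bijectionP.
have := epi _ translate (fun g => tau * translate g * tau^-1) translate_hom
  (homm_conj tau translate_hom).
have tK k : K k -> translate k K = K.
  move=> Kk; apply/seteqP; split=> h /= Kh; last by apply: KM => //; exact: KV.
  by rewrite -(mulVKg k h); apply: KM.
have t0 k : translate k set0 = set0 by apply/seteqP; split.
have tauK : tau K = set0 by rewrite /= /swap_set asboolT.
have tau0 : tau set0 = K.
  rewrite /= /swap_set; case: asboolP => [<-//|_]; by rewrite asboolT.
move=> /(_ _ x) H.
have {}H : translate x = tau * translate x * tau^-1.
  apply: H => k Kk; apply: bijectionP => A; rewrite tauV !bijM.
  have [AK|AK] := pselect (A = K); first by rewrite AK tauK t0 tau0 tK.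
  have [A0|A0] := pselect (A = set0); first by rewrite A0 tau0 tK // tauK t0.
  have -> : tau A = A by rewrite /= /swap_set !asboolF.
  rewrite /= /swap_set asboolF ?asboolF // => eqA.
    apply: A0; apply: (can_inj (bij_funK (translate k))).
    exact: etrans eqA (esym (t0 k)).
  apply: AK; apply: (can_inj (bij_funK (translate k))).
  exact: etrans eqA (esym (tK k Kk)).
(* At the empty set the first action does nothing and the second one moves K. *)
have := congr1 (fun s : bijection _ => s set0) H.
rewrite tauV !bijM tau0 t0 => /esym eq0.
have [tKx|tKx] := pselect (translate x K = K).
  have : translate x K x by rewrite /= mulVg.
  by rewrite tKx.
have xK : translate x K x by rewrite /= mulVg.
move: eq0; rewrite /= /swap_set asboolF // asboolF.
  by move=> e0; have : @set0 G x by rewrite -e0.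
by move=> e0; have : @set0 G x by rewrite -e0.
Qed.

End Epimorphisms.

Section FreeBasis.
Variables (G : groupType) (I : Type) (x : I -> G) (hx : free_basis x).

Lemma basis_ext (H : groupType) (f g : G -> H) : homm f -> homm g ->
  (forall i, f (x i) = g (x i)) -> forall z, f z = g z.
Proof.
move=> hf hg fg z.
have [phi [_ uphi]] := hx (fun i => f (x i)).
have <- : phi = f by apply: uphi.
by have <- : phi = g by apply: uphi; split.
Qed.

Lemma basis_lift (H : groupType) (y : I -> H) :
  exists phi : G -> H, homm phi /\ forall i, phi (x i) = y i.
Proof. by have [phi [? _]] := hx y; exists phi. Qed.

Lemma basis_ind (K : set G) : subgroup K -> (forall i, K (x i)) ->
  forall z, K z.
Proof.
move=> sK Kx; apply: epi_full => // H f g hf hg fg.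
by apply: basis_ext => // i; exact: fg.
Qed.
End FreeBasis.

Section FreeProduct.
Variables (G : groupType) (A B : set G).
Hypotheses (sA : subgroup A) (sB : subgroup B) (hAB : is_free_product A B).

Lemma homm_on (H : groupType) (f : G -> H) (C : set G) : homm f -> hom_on C f.
Proof. by move=> hf u v _ _; exact: hommM. Qed.

Lemma fprod_ext (H : groupType) (f g : G -> H) : homm f -> homm g ->
  (forall a, A a -> f a = g a) -> (forall b, B b -> f b = g b) ->
  forall z, f z = g z.
Proof.
move=> hf hg fgA fgB z.
have [phi [_ uphi]] := hAB (homm_on (C:=A) hf) (homm_on (C:=B) hf).
have <- : phi = f by apply: uphi.
by have <- : phi = g by apply: uphi; split=> // t ?; [rewrite fgA|rewrite fgB].
Qed.

Lemma fprod_lift (H : groupType) (f g : G -> H) : hom_on A f -> hom_on B g ->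
  exists phi : G -> H, [/\ homm phi,
    forall a, A a -> phi a = f a & forall b, B b -> phi b = g b].
Proof. by move=> hf hg; have [phi [? _]] := hAB hf hg; exists phi. Qed.

(** Generation: by [epi_full], uniqueness of the homomorphism out of A * B means
    that A and B generate. *)
Lemma fprod_ind (K : set G) : subgroup K -> A `<=` K -> B `<=` K ->
  forall z, K z.
Proof.
move=> sK AK BK; apply: epi_full => // H f g hf hg fg.
by apply: fprod_ext => // z; [move/AK|move/BK]; exact: fg.
Qed.

Lemma fprod_retract : exists r : G -> G, [/\ homm r,
  forall a, A a -> r a = a, forall b, B b -> r b = 1 & forall z, A (r z)].
Proof.
have [r [hr rA rB]] := fprod_lift (homm_on (C:=A) (@homm_id G))
  (homm_on (C:=B) (@homm_cst G G)).
exists r; split=> //; apply: fprod_ind => [|a Aa|b Bb] /=.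
- case: sA => A1 AM AV; split=> /= [|u v Au Av|u Au].
  + by rewrite homm1.
  + by rewrite hommM //; exact: AM.
  + by rewrite hommV //; exact: AV.
- by rewrite rA.
- by rewrite rB //; case: sA.
Qed.

End FreeProduct.

Lemma fprodC (G : groupType) (A B : set G) :
  is_free_product A B -> is_free_product B A.
Proof.
move=> h H al be hal hbe; have [phi [[h1 h2 h3] u]] := h H be al hbe hal.
by exists phi; split=> // psi [p1 p2 p3]; apply: u.
Qed.

(** * Reduced words *)

Section Words.
Variables (n : nat) (F : groupType) (x : 'I_n -> F) (hx : free_basis x).

Local Notation letter := ('I_n * bool)%type.
Implicit Types (l : letter) (w u v : seq letter) (g h z : F).

Definition linv l : letter := (l.1, ~~ l.2).
Lemma linvK : involutive linv.
Proof. by case=> i b; rewrite /linv /= negbK. Qed.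
Lemma linv_neq l : linv l != l.
Proof. by case: l => i []; rewrite /linv xpair_eqE andbC. Qed.

Definition reduced w := sorted (fun l l' => l' != linv l) w.

Definition lpush l w :=
  if w is l' :: w' then if l' == linv l then w' else l :: w else [:: l].

Lemma reduced_tl l w : reduced (l :: w) -> reduced w.
Proof. exact: path_sorted. Qed.

Lemma lpush_reduced l w : reduced w -> reduced (lpush l w).
Proof.
case: w => //= l' w' rw; case: ifP => [_|/negbT nl]; first exact: reduced_tl rw.
by rewrite /reduced /= nl.
Qed.

Lemma lpushE l w : reduced (l :: w) -> lpush l w = l :: w.
Proof. by case: w => //= l' w /andP[/negbTE ->]. Qed.

Lemma lpushK l w : reduced w -> lpush (linv l) (lpush l w) = w.
Proof.
case: w => /= [|l' w'] rw; first by rewrite linvK eqxx.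
case: ifP => [/eqP ll'|nl] /=; last by rewrite linvK eqxx.
by rewrite -ll' lpushE.
Qed.

(** Words that are not reduced are fixed, so that this is a bijection of all words. *)
Definition lact l w := if reduced w then lpush l w else w.

Lemma lactK l : cancel (lact l) (lact (linv l)).
Proof.
move=> w; rewrite {2}/lact; case: ifP => rw; last by rewrite /lact rw.
by rewrite /lact lpush_reduced // lpushK.
Qed.

Lemma lactKV l : cancel (lact (linv l)) (lact l).
Proof. by move=> w; rewrite -{1}(linvK l) lactK. Qed.

Definition letter_bij l : bijection (seq letter) :=
  Bijection (lactK l) (lactKV l).

Lemma reduced_lact l w : reduced (lact l w) = reduced w.
Proof. by rewrite /lact; case: ifP => // rw; rewrite lpush_reduced. Qed.

Definition lval l : F := if l.2 then x l.1 else (x l.1)^-1.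
Definition weval w : F := foldr (fun l g => lval l * g) 1 w.

Lemma lvalV l : lval (linv l) = (lval l)^-1.
Proof. by case: l => i []; rewrite /lval //= invgK. Qed.

Lemma weval_cat u v : weval (u ++ v) = weval u * weval v.
Proof.
elim: u => [|l u IH] /=; first by rewrite mul1g.
by rewrite IH mulgA.
Qed.

Lemma weval1 l : weval [:: l] = lval l. Proof. exact: mulg1. Qed.

Lemma weval_rcons w l : weval (rcons w l) = weval w * lval l.
Proof. by rewrite -cats1 weval_cat weval1. Qed.

Definition winv w := rev (map linv w).

Lemma weval_inv w : weval (winv w) = (weval w)^-1.
Proof.
elim: w => [|l w IH]; first by rewrite /= invg1.
by rewrite /winv /= rev_cons weval_rcons lvalV invgM -IH.
Qed.

Lemma lpush_eval l w : weval (lpush l w) = lval l * weval w.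
Proof.
case: w => //= l' w; case: ifP => //= /eqP ->.
by rewrite lvalV mulVKg.
Qed.

(** The van der Waerden action of F on reduced words, which yields normal forms:
    [word g] below is the image of the empty word. *)
Definition wact : F -> bijection (seq letter) :=
  sval (cid (basis_lift hx (fun i => letter_bij (i, true)))).

Lemma wact_hom : homm wact.
Proof. by rewrite /wact; case: cid => f [/= ? ?]. Qed.

Lemma wact_basis i : wact (x i) = letter_bij (i, true).
Proof. by rewrite /wact; case: cid => f [/= ? ?]. Qed.

Lemma wact_letter l : wact (lval l) = letter_bij l.
Proof.
case: l => i []; rewrite /lval /= ?(hommV _ wact_hom) wact_basis //.
by apply: bijectionP.
Qed.

Lemma reduced_wact g w : reduced (wact g w) = reduced w.
Proof.
move: g w; apply: (basis_ind hx (K := [set g | forall w, reduced (wact g w) = reduced w])).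
  split=> /= [w|g h gK hK w|g gK w].
  - by rewrite (homm1 wact_hom).
  - by rewrite (hommM wact_hom) bijM gK hK.
  - by rewrite -(gK (wact g^-1 w)) -bijM -(hommM wact_hom) mulgV (homm1 wact_hom).
by move=> i w; rewrite wact_basis; exact: reduced_lact.
Qed.

Lemma weval_wact g w : reduced w -> weval (wact g w) = g * weval w.
Proof.
move: g w; apply: (basis_ind hx
  (K := [set g | forall w, reduced w -> weval (wact g w) = g * weval w])).
  split=> /= [w|g h gK hK w rw|g gK w rw].
  - by rewrite (homm1 wact_hom) mul1g.
  - by rewrite (hommM wact_hom) bijM gK ?hK ?mulgA ?reduced_wact.
  - have := gK (wact g^-1 w); rewrite reduced_wact => /(_ rw).
    rewrite -bijM -(hommM wact_hom) mulgV (homm1 wact_hom) bij1 => ->.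
    by rewrite mulKg.
by move=> i w rw; rewrite wact_basis /= /lact rw lpush_eval.
Qed.

Definition word g := wact g [::].

Lemma word_reduced g : reduced (word g).
Proof. by rewrite reduced_wact. Qed.

Lemma wordK g : weval (word g) = g.
Proof. by rewrite weval_wact //= mulg1. Qed.

Lemma word_letter l g : word (lval l * g) = lpush l (word g).
Proof.
by rewrite /word (hommM wact_hom) bijM wact_letter /= /lact reduced_wact.
Qed.

Lemma word1 : word 1 = [::].
Proof. by rewrite /word (homm1 wact_hom). Qed.

Lemma word_eval w : reduced w -> word (weval w) = w.
Proof.
elim: w => [|l w IH] rw /=; first by rewrite word1.
by rewrite word_letter IH ?(reduced_tl rw) // lpushE.
Qed.

Lemma word_nil g : word g = [::] -> g = 1.
Proof. by move=> wg; rewrite -(wordK g) wg. Qed.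

Lemma reduced_cat u v : reduced (u ++ v) ->
  reduced u /\ reduced v.
Proof. by case/cat_sorted2. Qed.

Lemma reduced_glue u v w : v != [::] -> reduced (u ++ v) -> reduced (v ++ w) ->
  reduced (u ++ v ++ w).
Proof.
case: v => // l v _; case: u => [//|l' u].
rewrite /reduced /= !cat_path /= ?cat_path.
by move=> /andP[-> /andP[-> ->]] /andP[_ ->].
Qed.

Lemma reduced_inv w : reduced (winv w) = reduced w.
Proof.
rewrite /reduced /winv rev_sorted sorted_map; apply: eq_sorted => l l' /=.
by rewrite linvK eq_sym.
Qed.

Lemma word_inv g : word g^-1 = winv (word g).
Proof. by rewrite -{1}(wordK g) -weval_inv word_eval // reduced_inv word_reduced. Qed.

Definition norm g := size (word g).

Lemma normV g : norm g^-1 = norm g.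
Proof. by rewrite /norm word_inv size_rev size_map. Qed.

Lemma size_lpush l w : (size (lpush l w) <= (size w).+1)%N.
Proof. by case: w => //= l' w; case: ifP => _ /=; lia. Qed.

Lemma normM g h : (norm (g * h) <= norm g + norm h)%N.
Proof.
rewrite -{1}(wordK g) /norm; elim: (word g) => [|l w IH] /=; first by rewrite mul1g.
rewrite -mulgA word_letter; exact: leq_trans (size_lpush _ _) _.
Qed.

Lemma normMl g h : (norm h <= norm g + norm (g * h))%N.
Proof. by rewrite -{1}(mulKg g h) -(normV g) normM. Qed.

Lemma norm_eval w : reduced w -> norm (weval w) = size w.
Proof. by move=> rw; rewrite /norm word_eval. Qed.

Definition wpow w k := flatten (nseq k w).

Lemma wpowSr w k : wpow w k.+1 = wpow w k ++ w.
Proof.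
by rewrite /wpow -(addn1 k) nseqD flatten_cat /= cats0.
Qed.

Lemma weval_pow w k : weval (wpow w k) = weval w ^+ k.
Proof.
elim: k => [|k IH] /=; first by rewrite expg0.
by rewrite weval_cat IH expgS.
Qed.

Lemma size_wpow w k : size (wpow w k) = (k * size w)%N.
Proof. by elim: k => //= k IH; rewrite size_cat IH mulSn. Qed.

Lemma reduced_pow w k : reduced (w ++ w) -> reduced (wpow w k).
Proof.
have [->|w0] := eqVneq w [::]; first by rewrite /wpow; elim: k.
move=> rww; have rw := (reduced_cat rww).1.
elim: k => [//|[|k] IH]; first by rewrite /wpow /= cats0.
exact: reduced_glue.
Qed.

Lemma cyclic_reduced_or l w : reduced (l :: w) ->
  reduced ((l :: w) ++ (l :: w)) \/
  exists w', l :: w = l :: rcons w' (linv l).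
Proof.
move=> rw; have [e|ne] := eqVneq l (linv (last l w)).
  right; case: (lastP w) e => [/= e|w' l' e].
    by have := linv_neq l; rewrite -e eqxx.
  by exists w'; rewrite e last_rcons linvK.
by left; rewrite /reduced /= cat_path /= ne /= andbb; exact: rw.
Qed.

(** Up to conjugation a nontrivial element is cyclically reduced, and then the
    length of its powers is linear in the exponent. *)
Lemma pow_unbounded z N : z <> 1 -> exists k, (N <= norm (z ^+ k))%N.
Proof.
have [s] := ubnP (norm z); elim: s z N => // s IH z N zs z1.
have rz := word_reduced z.
case e: (word z) (rz) => [|l w] r; first by case: z1; exact: word_nil.
case: (cyclic_reduced_or r) => [rr|[w' ew]].
  exists N; rewrite -(wordK z) e -weval_pow norm_eval ?reduced_pow //.
  by rewrite size_wpow /=; lia.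
pose z' := weval w'.
have ez : z = lval l * z' * (lval l)^-1.
  by rewrite -(wordK z) e ew /= weval_rcons lvalV mulgA.
have rw' : reduced w'.
  by have := reduced_tl r; case: ew => -> ; rewrite -cats1 => /reduced_cat[].
have [|z1'|k Nk] := IH z' (N + 2)%N.
- rewrite norm_eval //; move: zs; rewrite /norm e; case: ew => ->.
  by rewrite /= size_rcons; lia.
- by apply: z1; rewrite ez z1' mulg1 mulgV.
exists k.
have -> : z ^+ k = lval l * z' ^+ k * (lval l)^-1.
  have -> : z = z' ^ (lval l)^-1 by rewrite ez conjgE invgK mulgA.
  by rewrite -conjXg conjgE invgK mulgA.
have nl : norm (lval l) = 1%N by rewrite -weval1 norm_eval.
have h1 := normMl (lval l) (z' ^+ k * (lval l)^-1).
have h2 := normM (z' ^+ k * (lval l)^-1) (lval l).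
rewrite mulgVK in h2; rewrite mulgA in h1.
move: Nk nl h1 h2; move: (norm _) (norm _) (norm _) (norm _); clear; lia.
Qed.

Lemma basis_pow_norm i k : norm (x i ^+ k) = k.
Proof.
have -> : x i = weval [:: (i, true)] by rewrite weval1.
rewrite -weval_pow norm_eval; first by rewrite size_wpow muln1.
by apply: reduced_pow; rewrite /reduced /= xpair_eqE eqxx.
Qed.

Lemma basis_neq1 i : x i <> 1.
Proof. by move=> e; have := basis_pow_norm i 1; rewrite e /norm expg1 word1. Qed.

(** Stripping the final powers of x i from h leaves an element commuting with
    x i; if it were nontrivial, its product with x i on the right would end in
    x i, and its product on the left would not. *)
Lemma basis_centralizer i h (K : set F) : subgroup K -> K (x i) ->
  h * x i = x i * h -> K h.
Proof.
move=> [K1 KM KV] Ki.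
have Kl l : l.1 = i -> K (lval l).
  by case: l => j [] /= ->; rewrite /lval //=; exact: KV.
have Cl l : l.1 = i -> lval l * x i = x i * lval l.
  by case: l => j [] /= ->; rewrite /lval //= mulVg mulgV.
have [s] := ubnP (norm h); elim: s h => // s IH h hs hC.
have rh := word_reduced h.
have := erefl (word h); case: {2}(word h) / (lastP (word h)) => [|w l] e.
  by rewrite (word_nil e).
have eh : h = weval w * lval l by rewrite -(wordK h) e weval_rcons.
have rw : reduced w by move: rh; rewrite e -cats1 => /reduced_cat[].
have [li|li] := eqVneq l.1 i.
  rewrite eh; apply: KM; last exact: Kl.
  apply: IH; first by move: hs; rewrite norm_eval // /norm e size_rcons.
  by apply: (@mulIg _ (lval l)); rewrite -mulgA -Cl // mulgA -eh hC eh mulgA.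
have r1 : reduced (rcons (word h) (i, true)).
  move: rh; rewrite e /reduced; case: (w) => [|l' w'] /=.
    by rewrite /= xpair_eqE eq_sym (negbTE li).
  by rewrite !rcons_path last_rcons => -> /=; rewrite xpair_eqE eq_sym (negbTE li).
have e1 : word (h * x i) = rcons (word h) (i, true).
  by rewrite -[RHS]word_eval // weval_rcons wordK.
have e2 : word (x i * h) = lpush (i, true) (word h) by rewrite -word_letter.
exfalso; move: e1; rewrite hC e2 e.
case: w {eh rw e rh r1 e2} => [|l' w'] /=.
  by case: ifP => // _ [e _]; move: li; rewrite -e eqxx.
case: ifP => _ e; first by have := congr1 size e; rewrite /= !size_rcons; lia.
have := congr1 (last l) e.
by rewrite /= !last_rcons => e3; move: li; rewrite e3 eqxx.
Qed.

Definition retr (J : pred 'I_n) : F -> F :=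
  sval (cid (basis_lift hx (fun i => if J i then x i else 1))).

Lemma retr_hom J : homm (retr J).
Proof. by rewrite /retr; case: cid => f [/= ? ?]. Qed.

Lemma retr_basis J i : retr J (x i) = if J i then x i else 1.
Proof. by rewrite /retr; case: cid => f [/= ? ?]. Qed.

Definition word_over (J : pred 'I_n) w := all (fun l => J l.1) w.

Lemma retr_eval J w : word_over J w -> retr J (weval w) = weval w.
Proof.
have hJ := retr_hom J.
elim: w => [|l w IH] /=; first by rewrite (homm1 hJ).
case/andP=> Jl /IH Jw; rewrite (hommM hJ) Jw; congr (_ * _).
by rewrite /lval; case: ifP => _; rewrite ?(hommV _ hJ) retr_basis Jl.
Qed.

Lemma retr_word J g : word_over J (word (retr J g)).
Proof.
have hJ := retr_hom J; rewrite /word.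
have -> : word_over J (wact (retr J g) [::]) = word_over J [::] => //.
move: g [::]; apply: (basis_ind hx (K :=
  [set g | forall w, word_over J (wact (retr J g) w) = word_over J w])).
  split=> /= [w|g h gK hK w|g gK w].
  - by rewrite (homm1 hJ) (homm1 wact_hom).
  - by rewrite (hommM hJ) (hommM wact_hom) bijM gK hK.
  - rewrite -(gK (wact _ w)) -bijM -(hommM wact_hom) (hommV _ hJ) mulgV.
    by rewrite (homm1 wact_hom).
move=> i w; rewrite retr_basis; case: ifP => Ji; last by rewrite (homm1 wact_hom).
rewrite wact_basis /= /lact; case: ifP => // _.
case: w => /= [|l w]; first by rewrite Ji.
by case: ifP => [/eqP -> |_] /=; rewrite Ji.
Qed.

End Words.

(** * Residual finiteness and the Hopf property *)

Lemma perm_extend (T : finType) (ps : seq (T * T)) :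
  uniq (unzip1 ps) -> uniq (unzip2 ps) ->
  exists s : {perm T}, forall p, p \in ps -> s p.1 = p.2.
Proof.
elim: ps => [|[a b] ps IH] /=; first by exists 1.
case/andP=> aps u1 /andP[bps u2]; have [s sP] := IH u1 u2.
exists (s * tperm (s a) b) => p; rewrite inE permM => /predU1P[->|pps] /=.
  exact: tpermL.
rewrite sP // tpermD //.
  rewrite -(sP _ pps) (inj_eq perm_inj); apply: contraNneq aps => ->.
  exact: map_f.
by apply: contraNneq bps => ->; exact: map_f.
Qed.

Section Residual.
Variables (n : nat) (F : groupType) (x : 'I_n -> F) (hx : free_basis x).

(** The reduced word of g, of length k, is drawn as a path with vertices
    0, ..., k.  Each letter acts on this path as a partial injection, by
    reducedness; extended to permutations, they let g move 0 to k. *)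
Lemma residually_finite (g : F) : g <> 1 ->
  exists k, exists2 theta : F -> {perm 'I_k}, homm theta & theta g <> 1.
Proof.
move=> g1; pose w := word hx g; pose k := size w.
have rw : reduced w := word_reduced hx g.
have k0 : (0 < k)%N.
  by rewrite /k lt0n size_eq0; apply/eqP => /word_nil.
have [l0 _] : exists l0 : 'I_n * bool, true.
  by move: k0; rewrite /k; case: (w) => // l _ _; exists l.
pose L j := nth l0 w j.
(* Reducedness: two adjacent letters with the same index have the same sign. *)
have adj j : (j.+1 < k)%N -> (L j).1 = (L j.+1).1 -> (L j).2 = (L j.+1).2.
  move=> jk e1; have /(sortedP l0)/(_ j jk) := rw; rewrite -/(L _) -/(L _).
  case: (L j) (L j.+1) e1 => i b [i' b'] /= ->.
  by rewrite /linv xpair_eqE eqxx /=; case: b b' => [] [].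
pose e1 j := if (L j).2 then j else j.+1.
pose e2 j := if (L j).2 then j.+1 else j.
pose ps i := [seq (inord (e1 j), inord (e2 j)) : 'I_k.+1 * 'I_k.+1
                | j <- iota 0 k & (L j).1 == i].
have psP i : exists s : {perm 'I_k.+1}, forall p, p \in ps i -> s p.1 = p.2.
  apply: perm_extend; rewrite /unzip1 /unzip2 -map_comp map_inj_in_uniq;
    rewrite ?filter_uniq ?iota_uniq // => j j';
    rewrite !mem_filter !mem_iota !add0n /= => /andP[/eqP ji jk] /andP[/eqP ji' jk'].
    move=> /= /(congr1 val) /=; rewrite !inordK; last 2 first.
    + by rewrite /e1; case: ifP; lia.
    + by rewrite /e1; case: ifP; lia.
    rewrite /e1; case: ifP => bj; case: ifP => bj' e; try lia.
      by move: (adj j'); rewrite -e jk ji ji' bj bj' => /(_ isT erefl).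
    by move: (adj j); rewrite e jk' ji ji' bj bj' => /(_ isT erefl).
  move=> /= /(congr1 val) /=; rewrite !inordK; last 2 first.
  + by rewrite /e2; case: ifP; lia.
  + by rewrite /e2; case: ifP; lia.
  rewrite /e2; case: ifP => bj; case: ifP => bj' e; try lia.
    by move: (adj j); rewrite e jk' ji ji' bj bj' => /(_ isT erefl).
  by move: (adj j'); rewrite -e jk ji ji' bj bj' => /(_ isT erefl).
have [theta [ht tx]] := basis_lift hx (fun i => sval (cid (psP i))).
exists k.+1, theta => //.
have tL j : (j < k)%N -> theta (lval x (L j)) (inord j) = inord j.+1.
  move=> jk; rewrite /lval.
  have jin : (inord (e1 j), inord (e2 j)) \in ps (L j).1.
    by apply/mapP; exists j; rewrite // mem_filter eqxx mem_iota.
  have := svalP (cid (psP (L j).1)) _ jin; rewrite -tx /=.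
  rewrite /e1 /e2; case: ifP => // _ <-.
  by rewrite (hommV _ ht) permK.
(* Permutations compose from left to right, so prefixes are read in order. *)
have tT j : (j <= k)%N -> theta (weval x (take j w)) (inord 0) = inord j.
  elim: j => [_|j IH jk]; first by rewrite take0 /= (homm1 ht) perm1.
  rewrite (take_nth l0) // weval_rcons (hommM ht) permM IH ?tL //.
  exact: ltnW.
move=> tg; have := tT k (leqnn k); rewrite take_size wordK tg perm1.
by move=> /(congr1 val) /=; rewrite !inordK //; lia.
Qed.

(** Precomposition with Psi and with Th acts on the finite set of homomorphisms
    to a finite symmetric group; being inverse on one side, these two maps are
    inverse on both sides.  So no finite quotient tells Th (Psi z) from z. *)
Lemma hopfian (Psi Th : F -> F) : homm Psi -> homm Th ->
  (forall z, Psi (Th z) = z) -> forall z, Th (Psi z) = z.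
Proof.
move=> hP hT PT z; apply/eqP; rewrite -divg_eq1; apply/eqP.
apply: contrapT => /residually_finite[k [theta ht]]; apply.
pose lift (t : {ffun 'I_n -> {perm 'I_k}}) := sval (cid (basis_lift hx t)).
have liftP t : homm (lift t) /\ forall i, lift t (x i) = t i.
  by rewrite /lift; case: cid.
pose f1 (t : {ffun 'I_n -> {perm 'I_k}}) : {ffun 'I_n -> {perm 'I_k}} :=
  [ffun i => lift t (Th (x i))].
pose f2 (t : {ffun 'I_n -> {perm 'I_k}}) : {ffun 'I_n -> {perm 'I_k}} :=
  [ffun i => lift t (Psi (x i))].
have l1 t y : lift (f1 t) y = lift t (Th y).
  apply: (basis_ext hx (liftP _).1 (homm_comp (liftP t).1 hT)) => i.
  by rewrite (liftP _).2 ffunE.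
have l2 t y : lift (f2 t) y = lift t (Psi y).
  apply: (basis_ext hx (liftP _).1 (homm_comp (liftP t).1 hP)) => i.
  by rewrite (liftP _).2 ffunE.
have f12 : cancel f2 f1.
  by move=> t; apply/ffunP => i; rewrite ffunE l2 PT (liftP t).2.
have f21 : cancel f1 f2 by apply: canF_sym.
pose t := [ffun i => theta (x i)].
have lt y : lift t y = theta y.
  by apply: (basis_ext hx (liftP _).1 ht) => i; rewrite (liftP _).2 ffunE.
have e : theta (Th (Psi z)) = theta z.
  by rewrite -!lt -l1 -l2 f21.
by rewrite (hommM ht) (hommV _ ht) e mulgV.
Qed.

End Residual.

(** * Free factors *)

Section Generated.
Variable F : groupType.
Implicit Types (A B K : set F) (g h z : F).

Definition sgen A : set F := [set z | forall K, subgroup K -> A `<=` K -> K z].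

Lemma sgen_subgroup A : subgroup (sgen A).
Proof.
split=> [K [] //|u v Au Av K sK AK|u Au K sK AK]; case: (sK) => K1 KM KV.
  by apply: KM; [exact: Au|exact: Av].
by apply: KV; exact: Au.
Qed.

Lemma sub_sgen A : A `<=` sgen A.
Proof. by move=> z Az K _; apply. Qed.

Lemma sgen_min A K : subgroup K -> A `<=` K -> sgen A `<=` K.
Proof. by move=> sK AK z; apply. Qed.

Lemma conj_subgroup A g : subgroup A -> subgroup (conj_set A g).
Proof.
case=> A1 AM AV; split.
- by exists 1 => //; rewrite conj1g.
- by move=> _ _ [u Au <-] [v Av <-]; exists (u * v); [exact: AM|rewrite conjMg].
- by move=> _ [u Au <-]; exists u^-1; [exact: AV|rewrite conjVg].
Qed.

Lemma conj_homm g : homm (fun z : F => z ^ g).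
Proof. by split=> [|u v]; rewrite ?conj1g ?conjMg. Qed.

Lemma conj_setK A g : conj_set (conj_set A g) g^-1 = A.
Proof.
apply/seteqP; split=> [_ [_ [u Au <-] <-]|z Az]; first by rewrite conjgK.
by exists (z ^ g); [exists z|rewrite conjgK].
Qed.

Lemma conj_setM A g h : conj_set (conj_set A g) h = conj_set A (g * h).
Proof.
apply/seteqP; split=> [_ [_ [u Au <-] <-]|_ [u Au <-]].
  by exists u; rewrite ?conjgM.
by exists (u ^ g); [exists u|rewrite conjgM].
Qed.

Lemma conj_set1 A : conj_set A 1 = A.
Proof.
apply/seteqP; split=> [_ [u Au <-]|z Az]; first by rewrite conjg1.
by exists z; rewrite ?conjg1.
Qed.

Lemma conj_setS A B g : A `<=` B -> conj_set A g `<=` conj_set B g.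
Proof. by move=> AB _ [u Au <-]; exists u => //; exact: AB. Qed.

Lemma conj_class_conj A g : conj_class (conj_set A g) = conj_class A.
Proof.
apply/seteqP; split=> [_ [h _ <-]|_ [h _ <-]].
  by exists (g * h) => //; rewrite conj_setM.
by exists (g^-1 * h) => //; rewrite conj_setM mulVKg.
Qed.

Lemma conj_classP A B : conj_class A = conj_class B -> exists g, A = conj_set B g.
Proof.
move=> e; have : conj_class A A by exists 1 => //; rewrite conj_set1.
by rewrite e => -[g _ <-]; exists g.
Qed.

Lemma conj_free_factor A g : free_factor A -> free_factor (conj_set A g).
Proof.
case=> sA [B sB AB]; split; first exact: conj_subgroup.
exists (conj_set B g); first exact: conj_subgroup.
move=> H al be hal hbe.
have hal' : hom_on A (fun z => al (z ^ g)).
  by move=> u v Au Av; rewrite conjMg hal //; [exists u|exists v].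
have hbe' : hom_on B (fun z => be (z ^ g)).
  by move=> u v Bu Bv; rewrite conjMg hbe //; [exists u|exists v].
have [phi [[hphi phiA phiB] uphi]] := AB H _ _ hal' hbe'.
exists (fun z => phi (z ^ g^-1)); split.
  split; first exact: (homm_comp hphi (conj_homm _)).
    by move=> _ [u Au <-]; rewrite conjgK phiA.
  by move=> _ [u Bu <-]; rewrite conjgK phiB.
move=> psi [hpsi psiA psiB]; apply/funext => z.
rewrite (uphi (fun z => psi (z ^ g))) ?conjgKV //; split.
- exact: (homm_comp hpsi (conj_homm _)).
- by move=> u Au; apply: psiA; exists u.
- by move=> u Bu; apply: psiB; exists u.
Qed.

Lemma conj_proper_factor A g :
  proper_free_factor A -> proper_free_factor (conj_set A g).
Proof.
case=> fA A1 AT; split; first exact: conj_free_factor.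
  move=> e; apply: A1; rewrite -(conj_setK A g) e.
  apply/seteqP; split=> [_ [u -> <-]|z ->]; first by rewrite conj1g.
  by exists 1; rewrite ?conj1g.
move=> e; apply: AT; rewrite -(conj_setK A g) e.
by apply/seteqP; split=> // z _; exists (z ^ g); rewrite ?conjgK.
Qed.

End Generated.

Section BasisFactors.
Variables (n : nat) (F : groupType) (x : 'I_n -> F) (hx : free_basis x).

Lemma retr_sgen (J : pred 'I_n) z :
  sgen [set x i | i in [set i | J i]] (retr hx J z).
Proof.
have hJ := retr_hom hx J.
move: z; apply: (basis_ind hx (K := [set z | sgen _ (retr hx J z)])).
  have [s1 sM sV] := sgen_subgroup [set x i | i in [set i | J i]].
  split=> /= [|u v Ku Kv|u Ku].
  - by rewrite (homm1 hJ).
  - by rewrite (hommM hJ); exact: sM.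
  - by rewrite (hommV _ hJ); exact: sV.
move=> i /=; rewrite retr_basis; case: ifP => Ji.
  by apply: sub_sgen; exists i.
by case: (sgen_subgroup [set x i | i in [set i | J i]]).
Qed.

Lemma sgen_retr (J : pred 'I_n) z :
  sgen [set x i | i in [set i | J i]] z -> retr hx J z = z.
Proof.
move: z; apply: sgen_min.
  exact: (equalizer_subgroup (retr_hom hx J) (@homm_id F)).
by move=> _ [i Ji <-] /=; rewrite retr_basis Ji.
Qed.

Lemma basis_free_factor (J : pred 'I_n) :
  free_factor (sgen [set x i | i in [set i | J i]]).
Proof.
split; first exact: sgen_subgroup.
exists (sgen [set x i | i in [set i | predC J i]]); first exact: sgen_subgroup.
move=> H al be hal hbe.
have [phi [hphi phix]] := basis_lift hx (fun i => if J i then al (x i) else be (x i)).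
have one_on (C : set F) (f : F -> H) : subgroup C -> hom_on C f -> f 1 = 1.
  by move=> [C1 _ _] hf; apply: (@mulgI _ (f 1)); rewrite -hf // !mulg1.
have inv_on (C : set F) (f : F -> H) u : subgroup C -> hom_on C f -> C u ->
    f u^-1 = (f u)^-1.
  move=> sC hf Cu; apply: (@mulgI _ (f u)); case: (sC) => _ _ CV.
  by rewrite -hf ?mulgV ?(one_on C) //; exact: CV.
have ext (P : pred 'I_n) (f : F -> H) :
    hom_on (sgen [set x i | i in [set i | P i]]) f ->
    (forall i, P i -> phi (x i) = f (x i)) ->
    forall z, sgen [set x i | i in [set i | P i]] z -> phi z = f z.
  set C := sgen _ => hf phif.
  have sC : subgroup C := sgen_subgroup _; case: (sC) => C1 CM CV.
  suff H0 : C `<=` C `&` [set z | phi z = f z] by move=> z /H0[].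
  apply: sgen_min; last first.
    by move=> _ [i Pi <-]; split; [apply: sub_sgen; exists i|exact: phif].
  split=> [|u v [Cu fu] [Cv fv]|u [Cu fu]].
  - by split=> //=; rewrite (homm1 hphi) (one_on C).
  - split; first exact: CM.
    by rewrite /= (hommM hphi) hf // -fu -fv.
  - split; first exact: CV.
    by rewrite /= (hommV _ hphi) (inv_on C) // fu.
exists phi; split.
  split=> //; first by apply: ext => // i Ji; rewrite phix Ji.
  by apply: ext => // i /negbTE nJi; rewrite phix nJi.
move=> psi [hpsi psiA psiB]; apply/funext; apply: (basis_ext hx) => // i.
rewrite phix; case: ifP => Ji.
  by rewrite psiA //; apply: sub_sgen; exists i.
by rewrite psiB //; apply: sub_sgen; exists i => //=; rewrite Ji.
Qed.

Lemma basis_proper_factor (J : pred 'I_n) i j : J i -> ~~ J j ->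
  proper_free_factor (sgen [set x i | i in [set i | J i]]).
Proof.
move=> Ji nJj; split; first exact: basis_free_factor.
  move=> e; have : sgen [set x i | i in [set i | J i]] (x i).
    by apply: sub_sgen; exists i.
  by rewrite e; exact: basis_neq1.
move=> e; have : sgen [set x i | i in [set i | J i]] (x j) by rewrite e.
move/sgen_retr; rewrite retr_basis (negbTE nJj) => /esym; exact: basis_neq1.
Qed.

Variable i0 : 'I_n.
Local Notation a := (x i0).
Local Notation sigma := (retr hx (predC1 i0)).

(** When g avoids the basis element a, the partial conjugation fixing a and
    conjugating the other basis elements by g is an automorphism.  A
    homomorphism with prescribed values on the new basis is found by conjugating
    the images of the x i by k, the value at g of the homomorphism with these
    values on the old basis; this k is also the new image of g. *)
Lemma conj_free_basis g : sigma g = g ->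
  free_basis (fun i => if i == i0 then a else x i ^ g).
Proof.
move=> sg H y.
have hs := retr_hom hx (predC1 i0).
have [psi [hpsi psix]] := basis_lift hx y.
pose k := psi g.
have [phi [hphi phix]] := basis_lift hx
  (fun i => if i == i0 then y i else k * y i * k^-1).
(* On the image of sigma, phi is psi followed by conjugation by k. *)
have phig : phi g = k.
  rewrite -sg.
  have -> : phi (sigma g) = k * psi (sigma g) * k^-1.
    apply: (basis_ext hx (homm_comp hphi hs)
      (homm_comp (homm_conj k hpsi) hs)) => i /=.
    rewrite retr_basis /=; case: eqP => [_|/eqP ni] /=.
      by rewrite !(homm1 hphi) (homm1 hpsi) mulg1 mulgV.
    by rewrite phix psix (negbTE ni).
  by rewrite sg mulgK.
exists phi; split.
  split=> // i; case: eqP => [->|/eqP ni]; first by rewrite phix eqxx.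
  rewrite conjgE (hommM hphi) (hommM hphi) (hommV _ hphi) phix (negbTE ni) phig.
  by rewrite !mulgA mulVg mul1g mulgVK.
move=> phi' [hphi' phi'x]; apply/funext.
pose K := [set z | phi z = phi' z].
have hK : subgroup K by exact: equalizer_subgroup.
have [K1 KM KV] := hK.
have Kx i : K (if i == i0 then a else x i ^ g).
  rewrite /K /= phi'x; case: eqP => [->|/eqP ni]; first by rewrite phix eqxx.
  rewrite conjgE (hommM hphi) (hommM hphi) (hommV _ hphi) phix (negbTE ni) phig.
  by rewrite !mulgA mulVg mul1g mulgVK.
have Ksg z : K (sigma z ^ g).
  move: z; apply: (basis_ind hx (K := [set z | K (sigma z ^ g)])).
    split=> [|u v Ku Kv|u Ku]; rewrite /= ?(homm1 hs) ?conj1g //.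
    - by rewrite (hommM hs) conjMg; exact: KM.
    - by rewrite (hommV _ hs) conjVg; exact: KV.
  move=> i; rewrite /= retr_basis /=; case: eqP (Kx i) => //= _ _.
  by rewrite conj1g.
have Kg : K g by have := Ksg g; rewrite sg conjgE mulgA mulVg mul1g.
apply: (basis_ind hx hK) => i; have := Kx i; case: eqP => [->//|_ Kxi].
rewrite -(conjgK g (x i)) conjgE invgK; apply: (KM) => //; apply: (KM) => //.
exact: KV.
Qed.

(** A retraction r onto W fixes a and a^g, so a^g = a^(r g): hence g (r g)^-1
    centralizes a, and lies in W by [basis_centralizer]. *)
Lemma factor_malnormal W g : free_factor W -> W a -> W (a ^ g) -> W g.
Proof.
case=> sW [Y sY WY] Wa Wag; case: (sW) => W1 WM WV.
have [r [hr rW rY rz]] := fprod_retract sW WY.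
have e : a ^ g = a ^ r g.
  rewrite -(rW _ Wag) !conjgE !(hommM hr) (hommV _ hr) (rW a) //.
have Wh : W (g * (r g)^-1).
  apply: (basis_centralizer hx sW Wa).
  apply: (@mulgI _ g^-1); rewrite !mulgA mulVg mul1g.
  apply: (@mulIg _ (r g)); rewrite mulgVK.
  by move: e; rewrite !conjgE !mulgA => ->.
by rewrite -(mulgVK (r g) g); apply: WM.
Qed.

(** Write F = W * Y.  If sigma is trivial on W, then sigma identifies Y with the
    free group on the other basis elements.  The endomorphism Psi that collapses
    W to <a> and is sigma on Y is therefore surjective, with section Th; by the
    Hopf property it is injective, which leaves no room in W outside <a>. *)
Lemma factor_kernel W : free_factor W -> W a ->
  (forall w, W w -> sigma w = 1) -> W `<=` sgen [set a].
Proof.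
case=> sW [Y sY WY] Wa W1.
have hs := retr_hom hx (predC1 i0).
pose eta := retr hx (pred1 i0); have he : homm eta := retr_hom hx (pred1 i0).
have [Psi [hPsi PsiW PsiY]] := fprod_lift WY (homm_on (C:=W) he)
  (homm_on (C:=Y) hs).
have [rho [hrho rhoY rhoW _]] := fprod_retract sY (fprodC WY).
have [Th [hTh Thx]] := basis_lift hx
  (fun i => if i == i0 then a else rho (x i)).
have sr z : sigma (rho z) = sigma z.
  apply: (fprod_ext WY (homm_comp hs hrho) hs) => z' z'in /=.
    by rewrite rhoW // (homm1 hs) W1.
  by rewrite rhoY.
have Pr z : Psi (rho z) = sigma (rho z).
  apply: (fprod_ext WY (homm_comp hPsi hrho) (homm_comp hs hrho)) => z' z'in /=.
    by rewrite rhoW // (homm1 hPsi) (homm1 hs).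
  by rewrite rhoY // PsiY.
have PT z : Psi (Th z) = z.
  apply: (basis_ext hx (homm_comp hPsi hTh) (@homm_id F)) => i /=.
  rewrite Thx; case: eqP => [->|/eqP ni].
    by rewrite PsiW // /eta retr_basis /= eqxx.
  by rewrite Pr sr retr_basis /= ni.
have TP := hopfian hx hPsi hTh PT.
have Te z : Th (eta z) = eta z.
  apply: (basis_ext hx (homm_comp hTh he) he) => i /=.
  rewrite /eta retr_basis /=; case: eqP => [->|_]; first by rewrite Thx eqxx.
  by rewrite (homm1 hTh).
move=> w Ww; rewrite -(TP w) PsiW // Te.
have := @retr_sgen (pred1 i0) w.
have -> // : [set x i | i in [set i | pred1 i0 i]] = [set a].
apply/seteqP; split=> [_ [i /= /eqP -> <-] //|_ ->].
by exists i0 => //=.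
Qed.

Lemma sgen1P z : sgen [set a] z -> exists k, z = a ^+ k \/ z = a ^- k.
Proof.
have H : sgen [set a] `<=` [set z | exists k l, z = a ^+ k * a ^- l].
  apply: sgen_min; last by move=> _ ->; exists 1%N, 0%N; rewrite expg1 expg0 invg1 mulg1.
  have C k l : a ^- k * a ^+ l = a ^+ l * a ^- k.
    by apply/esym/commuteV/commuteX2.
  split=> /=.
  - by exists 0%N, 0%N; rewrite expg0 invg1 mulg1.
  - move=> _ _ [k [l ->]] [k' [l' ->]]; exists (k + k')%N, (l' + l)%N.
    by rewrite !expgnDr invgM !mulgA -(mulgA (a ^+ k)) C !mulgA -(mulgA _ (a ^- l))
      -invgM -expgnDr addnC expgnDr invgM mulgA.
  - by move=> _ [k [l ->]]; exists l, k; rewrite invgM invgK.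
move=> /H[k [l ->]]; case: (leqP l k) => lk.
  by exists (k - l)%N; left; rewrite expgnFr.
exists (l - k)%N; right; rewrite expgnFr; last exact: ltnW.
by rewrite invgM invgK.
Qed.

Lemma basis_pow_inj k l : a ^+ k = a ^+ l -> k = l.
Proof. by move=> e; rewrite -(basis_pow_norm hx i0 k) e basis_pow_norm. Qed.

(** A retraction r onto A sends a to some power a^j; it fixes a nontrivial power
    of a lying in A, which forces j = 1. *)
Lemma factor_in_cyclic A : free_factor A -> A <> [set 1] ->
  A `<=` sgen [set a] -> A a.
Proof.
case=> sA [B sB AB] A1 Aa; case: (sA) => Aone _ AV.
have [r [hr rA _ rz]] := fprod_retract sA AB.
have [z Az z1] : exists2 z, A z & z <> 1.
  apply: contrapT => nz; apply: A1; apply/seteqP; split=> [z Az|_ -> //].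
  by apply: contrapT => z1; apply: nz; exists z.
have [k [k0 Ak]] : exists k, (0 < k)%N /\ A (a ^+ k).
  have [k ek] := sgen1P (Aa _ Az); exists k; split.
    by case: k ek => // ek; case: z1; case: ek => ->; rewrite expg0 ?invg1.
  case: ek => ek; first by rewrite -ek.
  by rewrite -(invgK (a ^+ k)) -ek; exact: AV.
have e : r a ^+ k = a ^+ k by rewrite -(hommX _ _ hr) rA.
have [j [ej|ej]] := sgen1P (Aa _ (rz a)).
  have j1 : j = 1%N.
    have := e; rewrite ej -expgnA => /basis_pow_inj jk.
    by nia.
  by move: (rz a); rewrite ej j1 expg1.
have : a ^+ (j * k + k) = a ^+ 0.
  by rewrite expgnDr expgnA expg0 -e ej expVgn mulgV.
by move/basis_pow_inj; lia.
Qed.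

End BasisFactors.

(** * Colourings of the Cayley tree and missed turns *)

Lemma common_suffix (T : eqType) (q v : seq T) : ~~ suffix v q ->
  exists q0 r c, [/\ q = q0 ++ c, v = r ++ c, r != [::] &
    q0 = [::] \/ exists q1 r1 l l', [/\ q0 = rcons q1 l, r = rcons r1 l' & l != l']].
Proof.
elim/last_ind: v q => [|v l IH] q; first by rewrite suffix0s.
case: (lastP q) => [_|q' l'].
  exists [::], (rcons v l), [::]; rewrite !cats0; split=> //; last by left.
  by rewrite -size_eq0 size_rcons.
have [<-|ll'] := eqVneq l l'.
  rewrite -!cats1 suffix_catl // eqxx => /IH[q0 [r [c [-> -> r0 H]]]].
  by exists q0, r, (c ++ [:: l]); split; rewrite ?catA.
exists (rcons q' l'), (rcons v l), [::]; rewrite !cats0; split=> //.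
  by rewrite -size_eq0 size_rcons.
by right; exists q', v, l', l; split=> //; rewrite eq_sym.
Qed.

Section Coloring.
Variables (n : nat) (F : groupType) (x : 'I_n -> F) (hx : free_basis x).
Variable i0 : 'I_n.
Local Notation a := (x i0).
Local Notation sigma := (retr hx (predC1 i0)).
Local Notation J := (predC1 i0).
Local Notation norm := (norm hx).
Local Notation word := (word hx).
Local Notation weval := (weval x).
Local Notation letter := ('I_n * bool)%type.

Let hs : homm sigma := retr_hom hx J.

Lemma flip_invol : involutive (fun p : F * bool => (p.1, p.2 (+) (p.1 == 1))).
Proof. by case=> g b /=; rewrite -addbA addbb addbF. Qed.

Definition flip : bijection (F * bool) := Bijection flip_invol flip_invol.

Lemma slideK g : cancel (fun p : F * bool => (sigma g * p.1, p.2))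
                        (fun p => (sigma g^-1 * p.1, p.2)).
Proof. by case=> h b /=; rewrite mulgA -(hommM hs) mulVg (homm1 hs) mul1g. Qed.

Lemma slideVK g : cancel (fun p : F * bool => (sigma g^-1 * p.1, p.2))
                         (fun p => (sigma g * p.1, p.2)).
Proof. by case=> h b /=; rewrite mulgA -(hommM hs) mulgV (homm1 hs) mul1g. Qed.

Definition slide g : bijection (F * bool) := Bijection (slideK g) (slideVK g).

Lemma slide_hom : homm slide.
Proof.
split=> [|g h]; apply: bijectionP => -[z b] /=; first by rewrite (homm1 hs) mul1g.
by rewrite (hommM hs) mulgA.
Qed.

Lemma norm_eq1 z : (0 < norm z)%N -> z != 1.
Proof. by apply: contraTneq => ->; rewrite /norm word1. Qed.

(** Let F = W * Y act on pairs (vertex, colour): W moves vertices through sigma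
    and keeps colours, while Y does the same after conjugation by the flip of
    colours at the vertex 1.  The colour of z is the one reached from
    (1, false).  Elements of W preserve it, and a letter changes it near the
    vertex 1 only. *)
Lemma coloring W : free_factor W -> W <> setT -> W a ->
  exists kappa : F -> bool,
  [/\ forall w z, W w -> kappa (w * z) = kappa z,
      forall z, kappa (sigma z) = kappa z,
      exists L, forall (l : letter) z, (L <= norm (sigma z))%N ->
        kappa (lval x l * z) = kappa z,
      kappa 1 = false & exists y, kappa y = true].
Proof.
case=> sW [Y sY WY] WT Wa.
have [phi [hphi phiW phiY]] := fprod_lift WY
  (homm_on (C:=W) slide_hom) (homm_on (C:=Y) (homm_conj flip slide_hom)).
have phi1 g p : (phi g p).1 = sigma g * p.1.
  move: g p; apply: (fprod_ind WY (K := [set g | forall p, (phi g p).1 = sigma g * p.1])).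
  - split=> /= [p|g h gK hK p|g gK p].
    + by rewrite (homm1 hphi) (homm1 hs) mul1g.
    + by rewrite (hommM hphi) bijM gK hK (hommM hs) mulgA.
    + apply: (@mulgI _ (sigma g)); rewrite -gK -bijM -(hommM hphi) mulgV.
      by rewrite (homm1 hphi) (hommV _ hs) mulVKg.
  - by move=> w Ww p; rewrite phiW.
  - by move=> y Yy p; rewrite phiY.
(* Every element changes colours at finitely many vertices only. *)
have phi2 g : exists L, forall p, (L <= norm p.1)%N -> (phi g p).2 = p.2.
  move: g; apply: (fprod_ind WY (K := [set g | exists L, forall p,
    (L <= norm p.1)%N -> (phi g p).2 = p.2])).
  - split=> /= [|g h [Lg gK] [Lh hK]|g [L gK]].
    + by exists 0%N => p _; rewrite (homm1 hphi).
    + exists (Lg + Lh + norm (sigma h))%N => p Lp.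
      rewrite (hommM hphi) bijM gK ?hK //.
        by apply: leq_trans Lp; rewrite addnAC leq_addl.
      rewrite phi1 -(leq_add2l (norm (sigma h))).
      apply: leq_trans (normMl hx (sigma h) p.1); apply: leq_trans Lp.
      by rewrite addnC leq_add2r leq_addr.
    + exists (L + norm (sigma g))%N => p Lp.
      rewrite -gK; first by rewrite -bijM -(hommM hphi) mulgV (homm1 hphi).
      rewrite phi1 (hommV _ hs) -(leq_add2l (norm (sigma g)^-1)).
      apply: leq_trans (normMl hx (sigma g)^-1 p.1).
      by rewrite (normV hx) addnC.
  - by move=> w Ww; exists 0%N => p _; rewrite phiW.
  - move=> y Yy; exists (norm (sigma y)).+1 => -[h b] /= Lh; rewrite phiY //=.
    rewrite (negbTE (norm_eq1 _)) ?(leq_trans _ Lh) // addbF.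
    rewrite (negbTE (norm_eq1 _)) ?addbF //.
    have := normMl hx (sigma y) h; move: Lh.
    move: (norm _) (norm _) (norm _); clear; lia.
exists (fun z => (phi z (1, false)).2); split.
- by move=> w z Ww; rewrite (hommM hphi) bijM phiW.
- move=> z; congr (bij_fun _ _).2.
  apply: (basis_ext hx (homm_comp hphi hs) hphi) => i /=.
  rewrite retr_basis /=; case: eqP => [->|] //=.
  rewrite (homm1 hphi) phiW //; apply: bijectionP => -[h b] /=.
  by rewrite retr_basis /= eqxx mul1g.
- pose L l := sval (cid (phi2 (lval x l))).
  exists (\max_l L l)%N => l z Lz; rewrite (hommM hphi) bijM.
  rewrite (svalP (cid (phi2 (lval x l)))) // phi1 mulg1.
  by apply: leq_trans Lz; exact: (leq_bigmax l).
- by rewrite (homm1 hphi).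
have [rho [hrho rhoY rhoW _]] := fprod_retract sY (fprodC WY).
(* A retraction rho onto Y factors through sigma, as a is in W; hence sigma is
   injective on Y, and a nontrivial y in Y takes 1 to the other colour. *)
have [y Yy y1] : exists2 y, Y y & y <> 1.
  apply: contrapT => nY; apply: WT; apply/seteqP; split=> // z _; move: z.
  apply: (fprod_ind WY) => // y Yy.
  have [->|] := eqVneq y 1; first by case: sW.
  by move/eqP=> y1; case: nY; exists y.
exists y; rewrite phiY //= eqxx.
have /eqP/negbTE -> // : sigma y * 1 <> 1.
rewrite mulg1 => sy; apply: y1; rewrite -(rhoY _ Yy).
rewrite -(basis_ext hx (homm_comp hrho hs) hrho) /= ?sy ?(homm1 hrho) // => i.
rewrite /= retr_basis /=; case: eqP => //= ->.
by rewrite (homm1 hrho) rhoW.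
Qed.

Lemma retr_word_over v : word_over J v -> sigma (weval v) = weval v.
Proof. exact: retr_eval. Qed.

(** The idea of the cut vertex lemma of Whitehead.  Words extending v to the left
    form the cone of v.  Cones of long words are monochromatic, but the cone of
    the empty word is not, since sigma(W) contains long elements and the two
    colours are carried by W and by another coset W y.  So some v has a cone with two colours while
    the cones of its children l :: v are monochromatic; take children
    y1 :: v and y2 :: v of different colours. *)
Lemma missed_turn W : proper_free_factor W -> W a ->
  (exists2 w, W w & sigma w <> 1) ->
  exists (y1 y2 : letter) L, [/\ y1.1 != i0, y2.1 != i0, y1 != y2 &
    forall w1 w2 w, W w ->
      reduced (rcons w1 y1) -> reduced (rcons w2 y2) ->
      word_over J w1 -> word_over J w2 -> (L <= size w1)%N -> (L <= size w2)%N ->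
      weval (rcons w1 y1) <> sigma w * weval (rcons w2 y2)].
Proof.
case=> fW _ WT Wa [w0 Ww0 sw0].
have [W1 WM WV] := fW.1.
have [ka [kW ks [L kL] k1 [y ky]]] := coloring fW WT Wa.
(* Only long words of the cone of v matter: the colour is taken at infinity. *)
pose col v (c : bool) := forall u, word_over J u -> reduced (u ++ v) ->
  (L <= size (u ++ v))%N -> ka (weval (u ++ v)) = c.
have long_mono v : word_over J v -> (L <= size v)%N -> reduced v -> exists c, col v c.
  move=> Jv Lv rv; exists (ka (weval v)); elim=> [//|l u IH] /= /andP[Jl Ju] rluv _.
  have ruv := reduced_tl rluv.
  have Luv : (L <= size (u ++ v))%N by rewrite size_cat (leq_trans Lv) ?leq_addl.
  rewrite kL; first exact: IH.
  rewrite retr_word_over ?norm_eval // /word_over all_cat; exact/andP.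
have not_mono0 : ~ exists c, col [::] c.
  move=> [c colc].
  have kc z : (L <= norm (sigma z))%N -> ka z = c.
    move=> Lz; have := colc (word (sigma z)).
    rewrite cats0 wordK ks; apply => //; first exact: retr_word.
    exact: word_reduced.
  have [k Lk] := pow_unbounded hx (L + norm (sigma y)) sw0.
  have Wk : W (w0 ^+ k).
    elim: (k) => [|j IH]; first by rewrite expg0.
    by rewrite expgS; exact: WM.
  have e1 : ka (w0 ^+ k) = false by rewrite -(mulg1 (w0 ^+ k)) kW.
  have e2 : ka (w0 ^+ k * y) = true by rewrite kW.
  move: e1; rewrite kc; last first.
    by rewrite (hommX _ _ hs); apply: leq_trans Lk; exact: leq_addr.
  rewrite -(kc (w0 ^+ k * y)) ?e2 // (hommM hs) (hommX _ _ hs).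
  rewrite -(leq_add2r (norm (sigma y))); apply: leq_trans Lk _.
  have := normM hx (sigma w0 ^+ k * sigma y) (sigma y)^-1.
  by rewrite mulgK (normV hx).
pose child v (l : letter) := l.1 != i0 /\ reduced (l :: v).
(* An outermost v: cones are monochromatic beyond length L. *)
have [v [Jv rv nv cv]] : exists v, [/\ word_over J v, reduced v, ~ (exists c, col v c) &
    forall l, child v l -> exists c, col (l :: v) c].
  apply: contrapT => nov.
  suff H : forall v, word_over J v -> reduced v -> exists c, col v c.
    by apply: not_mono0; exact: H.
  move=> v; have [s] := ubnP (L - size v); elim: s v => // s IH v vs Jv rv.
  have [Lv|Lv] := leqP L (size v); first exact: long_mono.
  apply: contrapT => nv; apply: nov; exists v; split=> // l [li rl].
  apply: IH => //; last by rewrite /word_over /= li.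
  by rewrite /=; lia.
have Lv : (size v < L)%N.
  by rewrite ltnNge; apply/negP => /long_mono; case/(_ Jv rv)=> c ?; apply: nv; exists c.
have [y1 [y2 [c [[y1i ry1] [y2i ry2] y12 c1 c2]]]] : exists y1 y2 c,
    [/\ child v y1, child v y2, y1 != y2, col (y1 :: v) c & col (y2 :: v) (~~ c)].
  apply: contrapT => noy; apply: nv.
  have split_last u c : (forall l, child v l -> col (l :: v) c) -> word_over J u ->
      reduced (u ++ v) -> (L <= size (u ++ v))%N -> ka (weval (u ++ v)) = c.
    move=> ch; case: (lastP u) => [|u' l]; first by rewrite /= leqNgt Lv.
    rewrite cat_rcons /word_over all_rcons => /andP[li Ju'] r; apply: ch => //.
    by split=> //; have [] := reduced_cat r.
  have [[l [chl coll]]|nol] := pselect (exists l, child v l /\ col (l :: v) true).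
    exists true => u; apply: split_last => l' chl'.
    have [<-//|ll'] := eqVneq l l'.
    have [[] // cl'] := cv _ chl'.
    by case: noy; exists l, l', true.
  exists false => u; apply: split_last => l' chl'.
  have [[] // cl'] := cv _ chl'.
  by case: nol; exists l'.
exists y1, y2, L; split=> // w1 w2 w Ww r1 r2 J1 J2 L1 L2 e.
have H y' u c' : y'.1 != i0 -> reduced (y' :: v) -> col (y' :: v) c' ->
    reduced (rcons u y') -> word_over J u -> (L <= size u)%N ->
    ka (weval (rcons u y') * weval v) = c' /\
    sigma (weval (rcons u y') * weval v) = weval (rcons u y') * weval v.
  move=> y'i ry' cy' ru Ju Lu; rewrite -weval_cat cat_rcons; split.
    apply: cy' => //; last by rewrite size_cat (leq_trans Lu) ?leq_addr.
    by rewrite -cat1s; apply: reduced_glue; rewrite ?cats1.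
  by apply: retr_word_over; rewrite /word_over all_cat /= y'i; apply/andP.
have [k1c _] := H _ _ _ y1i ry1 c1 r1 J1 L1.
have [k2c s2] := H _ _ _ y2i ry2 c2 r2 J2 L2.
(* Translating by v turns the words ending in y1 and y2 into words of the two
   cones, without leaving the coset of W. *)
move: k1c; rewrite e -mulgA -s2 -(hommM hs) ks kW // k2c.
by case: (c).
Qed.

Variable u : seq letter.
Hypothesis uturn : forall y1 y2 : letter, y1.1 != i0 -> y2.1 != i0 ->
  y1 != y2 -> exists s t, u = s ++ y1 :: linv y2 :: t.

Definition avoids j (W : set F) := exists L, forall p, W p ->
  (L <= norm (sigma p))%N -> ~~ suffix (wpow u j) (word (sigma p)).

Lemma word_over_winv (w : seq letter) : word_over J (winv w) = word_over J w.
Proof. by rewrite /word_over /winv all_rev all_map. Qed.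

Lemma winv_cat (v w : seq letter) : winv (v ++ w) = winv w ++ winv v.
Proof. by rewrite /winv map_cat rev_cat. Qed.

(** Let p in W and p' in W' be long, with the word of p' ending in u^(j+1) and
    that of p not ending in u^j.  Inside the copy of u that precedes u^j, choose
    the turn missed by Z, namely y1 followed by the inverse of y2, and translate
    by the part d of the word of p' starting with this inverse: p' d^-1 ends in
    y1, while p d^-1 ends in y2, because the words of p and p' already differ
    inside u^j. *)
Lemma avoids_step j Z W W' : proper_free_factor Z -> Z a ->
  subgroup W -> W `<=` Z -> W' `<=` Z ->
  (exists2 w, W w & sigma w <> 1) ->
  avoids j W -> avoids j.+1 W'.
Proof.
move=> pZ Za [W1 WM _] WZ W'Z [w0 Ww0 sw0] [LW aW].
have [[[Z1 ZM ZV] _] _ _] := pZ.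
have [|y1 [y2 [L [y1i y2i y12 turn]]]] := missed_turn pZ Za.
  by exists w0 => //; exact: WZ.
have [s [t eu]] := uturn y1i y2i y12.
have [k Lk] := pow_unbounded hx (LW + L + size (wpow u j)) sw0.
pose p := w0 ^+ k.
have Wp : W p.
  rewrite /p; elim: (k) => [|i IH]; first by rewrite expg0.
  by rewrite expgS; exact: WM.
have np : norm (sigma p) = size (word (sigma p)) by [].
rewrite -(hommX _ _ hs) -/p in Lk.
have {}aW : ~~ suffix (wpow u j) (word (sigma p)).
  by apply: aW => //; apply: leq_trans Lk; rewrite -addnA leq_addr.
exists (L + size (wpow u j.+1))%N => p' W'p' Lp'.
apply/negP => /suffixP[w' ew'].
(* The words of p and u^j share the suffix c; the part r of u^j before it is
   not empty. *)
have [q0 [r [c [eq0 er r0 qr]]]] := common_suffix aW.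
have rp := word_reduced hx (sigma p); rewrite eq0 in rp.
have rp' := word_reduced hx (sigma p'); rewrite ew' in rp'.
have Jp := retr_word hx J p; rewrite -/(word _) eq0 in Jp.
have Jp' := retr_word hx J p'; rewrite -/(word _) ew' in Jp'.
have esplit : w' ++ wpow u j.+1 =
    rcons (w' ++ s) y1 ++ (linv y2 :: t ++ r) ++ c.
  by rewrite /wpow /= -/(wpow u j) er eu cat_rcons -!catA.
rewrite esplit in ew' rp' Jp'.
have rtr : reduced (linv y2 :: t ++ r).
  by have [_ /reduced_cat[]] := reduced_cat rp'.
have e2 : rcons (q0 ++ winv (t ++ r)) y2 = q0 ++ winv (linv y2 :: t ++ r).
  have -> : linv y2 :: t ++ r = [:: linv y2] ++ (t ++ r) by [].
  have ew : winv [:: linv y2] = [:: y2] by rewrite /winv /rev /= linvK.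
  by rewrite (winv_cat [:: linv y2]) ew -cats1 -catA.
apply: (turn (w' ++ s) (q0 ++ winv (t ++ r)) (p' * p^-1)).
- by apply: ZM; [exact: W'Z|apply: ZV; exact: WZ].
- by have [] := reduced_cat rp'.
- rewrite e2; case: qr => [->|[q1 [r1 [l [l' [eq1 er1 ll']]]]]].
    by rewrite reduced_inv.
  have rq : reduced (q1 ++ [:: l]) by rewrite cats1 -eq1; case: (reduced_cat rp).
  rewrite eq1 -cats1 -catA; move: rtr; rewrite -(reduced_inv (_ :: _)).
  have -> : linv y2 :: t ++ r = (linv y2 :: t ++ r1) ++ [:: l'].
    by rewrite er1 -cats1 /= catA.
  have ew : winv [:: l'] = [:: linv l'] by [].
  rewrite winv_cat ew => ri; apply: (@reduced_glue _ q1 [:: l]) => //.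
  rewrite /= /reduced /= in ri *; rewrite ri andbT.
  by rewrite (inj_eq (can_inj (@linvK n))) eq_sym.
- by move: Jp'; rewrite /word_over all_cat all_rcons => /andP[/andP[_ ->]].
- move: Jp Jp'; rewrite /word_over !all_cat => /andP[-> _] /=.
  rewrite -/(word_over J (winv _)) word_over_winv /word_over /= !all_cat.
  by move=> /andP[_ /andP[/andP[_ ->]]].
- rewrite size_cat; apply: leq_trans (leq_addr _ _).
  by rewrite -(leq_add2r (size (wpow u j.+1))) -size_cat esplit -ew'.
- rewrite size_cat; apply: leq_trans (leq_addr _ _).
  rewrite -(leq_add2r (size c)) -size_cat -eq0; apply: leq_trans Lk.
  by rewrite er size_cat; move: (size _) (size _); clear; lia.
rewrite e2 weval_cat weval_inv mulgA (hommM hs) (hommV _ hs).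
set h := weval (linv y2 :: t ++ r).
have -> : sigma p' = weval (rcons (w' ++ s) y1) * h * weval c.
  by rewrite -(wordK hx (sigma p')) ew' !weval_cat mulgA.
have -> : sigma p = weval q0 * weval c.
  by rewrite -(wordK hx (sigma p)) eq0 weval_cat.
move: h => h.
by rewrite invgM !mulgA mulgK mulgVK mulgK.
Qed.

End Coloring.

(** * A word containing all turns *)

Section FullWord.
Variables (n : nat) (i0 i1 i2 : 'I_n).
Hypotheses (i10 : i1 != i0) (i20 : i2 != i0) (i12 : i1 != i2).
Local Notation letter := ('I_n * bool)%type.
Local Notation J := (predC1 i0).

Lemma connector (l l' : letter) :
  exists k : letter, [/\ k.1 != i0, k != linv l & l' != linv k].
Proof.
pose s := [:: (i1, true); (i1, false); (i2, true); (i2, false)].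
have us : uniq s by rewrite /= !inE !xpair_eqE /= !(negbTE i12) !andbF !eqxx.
have [/hasP[k ks kn]|/hasPn H] :=
  boolP (has (fun k => k \notin [:: linv l; linv l']) s).
  exists k; move: kn; rewrite !inE negb_or => /andP[kl kl']; split=> //.
    by move: ks; rewrite !inE => /or4P[] /eqP ->.
  by apply: contraNneq kl' => ->; rewrite linvK.
have /(uniq_leq_size us) // : {subset s <= [:: linv l; linv l']}.
by move=> k /H; rewrite negbK.
Qed.

(** Starting and ending with the letter i2 makes u cyclically reduced, and also
    reduced when preceded by a power of the basis element i1. *)
Lemma full_word : exists u : seq letter,
  [/\ word_over J ((i2, true) :: u), reduced ((i2, true) :: u),
      last (i2, true) u = (i2, true) &
   forall y1 y2 : letter, y1.1 != i0 -> y2.1 != i0 -> y1 != y2 ->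
     exists s t, (i2, true) :: u = s ++ y1 :: linv y2 :: t].
Proof.
pose c : letter := (i2, true).
suff H (ps : seq (letter * letter)) :
    (forall p, p \in ps -> [/\ p.1.1 != i0, p.2.1 != i0 & p.1 != p.2]) ->
    exists u, [/\ word_over J (c :: u), reduced (c :: u), last c u = c &
      forall p, p \in ps -> exists s t, c :: u = s ++ p.1 :: linv p.2 :: t].
  have [p|u [u1 u2 u3 u4]] := H [seq p <- enum {: letter * letter} |
      [&& p.1.1 != i0, p.2.1 != i0 & p.1 != p.2]].
    by rewrite mem_filter => /andP[/and3P[]].
  exists u; split=> // y1 y2 h1 h2 h12.
  by apply: (u4 (y1, y2)); rewrite mem_filter mem_enum /= h1 h2 h12.
elim: ps => [_|[y1 y2] ps IH hps].
  by exists [::]; split=> //; apply/andP.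
have [p pps|u [Ju ru lu pu]] := IH; first by apply: hps; rewrite inE pps orbT.
have [/= h1 h2 h12] := hps (y1, y2) (mem_head _ _).
have [k1 [k10 k1a k1b]] := connector c y1.
have [k2 [k20 k2a k2b]] := connector (linv y2) c.
exists (u ++ [:: k1; y1; linv y2; k2; c]); split.
- by move: Ju; rewrite /word_over /= all_cat /= => /andP[-> ->] /=; rewrite ?i20 k10 k20 h1 h2.
- move: ru; rewrite /reduced /= cat_path lu => -> /=.
  rewrite k1a k1b k2a k2b !andbT /=.
  by apply: contraNneq h12 => /(can_inj (@linvK n)) ->.
- by rewrite last_cat.
- move=> p; rewrite inE => /predU1P[->|/pu[s [t e]]].
    by exists (c :: u ++ [:: k1]), [:: k2; c]; rewrite /= -catA.
  by exists s, (t ++ [:: k1; y1; linv y2; k2; c]); rewrite -cat_cons e -catA.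
Qed.
End FullWord.

(** * Paths in the link of a rank one factor *)

Section Classes.
Variable F : groupType.
Implicit Types A B W : set F.

Lemma proper_factor W : proper_free_factor W -> free_factor W.
Proof. by case. Qed.

Lemma proper_subgroup W : proper_free_factor W -> subgroup W.
Proof. by case=> -[]. Qed.

Lemma conj_class_subl A A' B : conj_class A = conj_class A' ->
  sub_up_to_conj A B -> sub_up_to_conj A' B.
Proof.
move=> /esym/conj_classP[g ->] [h AB]; exists (h * g).
by rewrite -conj_setM; exact: conj_setS.
Qed.

Lemma conj_class_subr A B B' : conj_class B = conj_class B' ->
  sub_up_to_conj A B -> sub_up_to_conj A B'.
Proof.
by move=> /conj_classP[g ->] [h AB]; exists (g * h); rewrite -conj_setM.
Qed.

Lemma ff_comparable (s : set (set (set F))) A B : ff_simplices s ->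
  s (conj_class A) -> s (conj_class B) ->
  sub_up_to_conj A B \/ sub_up_to_conj B A.
Proof.
move=> [k [C [k0 Cff Cch ->]]] [i /= ik iA] [j /= jk jB].
have Cmono i' j' : (i' <= j')%N -> (j' < k)%N -> sub_up_to_conj (C i') (C j').
  elim: j' => [|j' IH]; first by rewrite leqn0 => /eqP -> _; exact: sub_up_to_conj_refl.
  rewrite leq_eqVlt => /orP[/eqP -> _|ij jk']; first exact: sub_up_to_conj_refl.
  by apply: sub_up_to_conj_trans (Cch _ jk'); apply: IH => //; exact: ltnW.
case: (leqP i j) => [ij|/ltnW ji]; [left|right].
  exact: conj_class_subl iA (conj_class_subr jB (Cmono _ _ ij jk)).
exact: conj_class_subl jB (conj_class_subr iA (Cmono _ _ ji ik)).
Qed.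

Lemma ff_vertex (s : set (set (set F))) U : ff_simplices s -> s U ->
  exists2 A, proper_free_factor A & U = conj_class A.
Proof. by move=> [k [C [_ Cff _ ->]]] [i /= ik <-]; exists (C i) => //; exact: Cff. Qed.

Lemma conj_set_in A g : subgroup A -> A g -> conj_set A g = A.
Proof.
move=> [A1 AM AV] Ag; apply/seteqP; split=> [_ [v Av <-]|v Av].
  by rewrite conjgE; apply: (AM); [exact: AV|exact: AM].
exists (v ^ g^-1); last by rewrite conjgKV.
by rewrite conjgE invgK; apply: (AM) => //; apply: AM => //; exact: AV.
Qed.
End Classes.

Section Link.
Variables (n : nat) (F : groupType) (x : 'I_n -> F) (hx : free_basis x).
Variables (i0 i1 i2 : 'I_n).
Hypotheses (i10 : i1 != i0) (i20 : i2 != i0) (i12 : i1 != i2).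
Local Notation a := (x i0).
Local Notation b := (x i1).
Local Notation J := (predC1 i0).
Local Notation sigma := (retr hx J).
Local Notation A := (sgen [set a]).

Let hs : homm sigma := retr_hom hx J.

(** Vertices of the link of [A], with A = <a>, can only lie above [A]. *)
Lemma factor_below W : proper_free_factor W -> sub_up_to_conj W A ->
  conj_class W = conj_class A.
Proof.
move=> pW [g WA]; have := conj_setS (g := g^-1) WA; rewrite conj_setK => WA'.
have [fW' W'1 _] := conj_proper_factor g^-1 pW.
have W'a := factor_in_cyclic hx fW' W'1 WA'.
have <- : conj_set W g^-1 = A.
  by apply/seteqP; split=> //; apply: sgen_min; [exact: fW'.1|move=> _ ->].
by rewrite conj_class_conj.
Qed.

Lemma cyclic_sub W : subgroup W -> W a -> A `<=` W.
Proof. by move=> sW Wa; apply: sgen_min => // _ ->. Qed.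

Lemma cyclic_sub_conj W : sub_up_to_conj A W -> exists g, W (a ^ g).
Proof.
move=> [g AW]; have [v Wv e] := AW a (sub_sgen (erefl : [set a] a)).
by exists g^-1; rewrite -e conjgK.
Qed.

Variable u : seq ('I_n * bool).
Hypothesis uJ : word_over J u.
Hypothesis uu : reduced (u ++ u).
Hypothesis uturn : forall y1 y2 : 'I_n * bool, y1.1 != i0 -> y2.1 != i0 ->
  y1 != y2 -> exists s t, u = s ++ y1 :: linv y2 :: t.

Local Notation avoids := (avoids hx i0 u).

(** By [factor_malnormal] a class has at most one representative W through a, so
    the condition on the elements of W is one on the class U. *)
Definition located j (U : set (set F)) := exists W,
  [/\ proper_free_factor W, W a, conj_class W = U & avoids j W].

(** Going up from W, some conjugate of the next factor contains W, hence a.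
    Going down, some conjugate B1 of the next factor lies in W and contains a
    conjugate of a; by malnormality of W, B1 can be moved inside W to contain a
    itself. *)
Lemma located_step j U V : located j U -> U <> conj_class A ->
  V <> conj_class A -> ff_simplices [set conj_class A; U; V] ->
  located j.+1 V.
Proof.
move=> [W [pW Wa eU aW]] UA VA fs.
have [B pB eV] := ff_vertex fs (or_intror erefl : [set conj_class A; U; V] V).
have sW : subgroup W := proper_subgroup pW.
have Wmove : exists2 w, W w & sigma w <> 1.
  apply: contrapT => nw; apply: UA; rewrite -eU; congr conj_class.
  apply/seteqP; split; last exact: cyclic_sub.
  refine (@factor_kernel n F x hx i0 W (proper_factor pW) Wa _) => w Ww.
  by apply: contrapT => sw; apply: nw; exists w.
have [[WB]|] : sub_up_to_conj W B \/ sub_up_to_conj B W.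
  by apply: (ff_comparable fs); [left; right|right].
  move=> WB'; pose W' := conj_set B WB.
  have pW' : proper_free_factor W' by exact: conj_proper_factor.
  exists W'; split=> //; [exact: WB'|by rewrite conj_class_conj|].
  by apply: (avoids_step uturn pW' _ sW) => //; exact: WB'.
move=> [g BW].
have pB1 := conj_proper_factor g^-1 pB; set B1 := conj_set B g^-1 in pB1.
have B1W : B1 `<=` W by have := conj_setS (g := g^-1) BW; rewrite conj_setK.
have eB1 : conj_class B1 = V by rewrite conj_class_conj.
have [|/(factor_below pB1)] : sub_up_to_conj A B1 \/ sub_up_to_conj B1 A.
- by apply: (ff_comparable fs); [left; left|right].
- move=> /cyclic_sub_conj[h B1h].
  have Wh : W h by apply: (factor_malnormal hx (proper_factor pW) Wa); exact: B1W.
  exists (conj_set B1 h^-1); split.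
  + exact: conj_proper_factor.
  + by exists (a ^ h); rewrite ?conjgK.
  + by rewrite conj_class_conj.
  + apply: (avoids_step uturn pW Wa sW _ _ Wmove aW) => //.
    rewrite -(conj_set_in sW (_ : W h^-1)); first exact: conj_setS.
    by case: sW => _ _; apply.
- by rewrite eB1 => /VA.
Qed.

Definition twister N := weval x (wpow u N.+2).
Definition pair_factor := sgen [set a; b].
Definition twisted_factor N := sgen [set a; b ^ twister N].

Lemma twister_fixed N : sigma (twister N) = twister N.
Proof.
apply: retr_eval; rewrite /wpow; elim: N.+2 => //= k IH.
by rewrite /word_over all_cat; apply/andP.
Qed.

Lemma pair_basis (z : 'I_n -> F) :
  [set z i | i in [set i | (pred2 i0 i1) i]] = [set z i0; z i1].
Proof.
apply/seteqP; split=> [_ [i /= /orP[/eqP ->|/eqP ->] <-]|_ [->|->]].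
- by left.
- by right.
- by exists i0; rewrite //= eqxx.
- by exists i1; rewrite //= eqxx orbT.
Qed.

Lemma pair_proper : proper_free_factor pair_factor.
Proof.
rewrite /pair_factor -(pair_basis x); apply: (basis_proper_factor hx (i := i0) (j := i2)).
  by rewrite /= eqxx.
by rewrite /= negb_or i20 eq_sym.
Qed.

Lemma twisted_proper N : proper_free_factor (twisted_factor N).
Proof.
have hx' := conj_free_basis (twister_fixed N).
pose x' i := if i == i0 then a else x i ^ twister N.
have -> : twisted_factor N = sgen [set x' i | i in [set i | (pred2 i0 i1) i]].
  by rewrite pair_basis /x' eqxx (negbTE i10).
apply: (basis_proper_factor hx' (i := i0) (j := i2)).
  by rewrite /= eqxx.
by rewrite /= negb_or i20 eq_sym.
Qed.

Lemma basis_elt_proper i j : i != j -> proper_free_factor (sgen [set x i]).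
Proof.
move=> ij; have -> : [set x i] = [set x k | k in [set k | (pred1 i) k]].
  by apply/seteqP; split=> [_ ->|_ [k /= /eqP -> <-]] //; exists i => /=.
by apply: (basis_proper_factor hx (i := i) (j := j)); rewrite /= ?eqxx // eq_sym.
Qed.

Hypothesis ul : exists u', u = (i2, true) :: u'.

(** Here sigma takes values in the powers of b, whereas u contains the letter i2. *)
Lemma pair_avoids : avoids 1 pair_factor.
Proof.
exists 0%N => p Vp _; apply/negP => /suffixP[w e].
have e1 : sigma p = retr hx (pred1 i1) p.
  have := @sgen_retr _ _ _ hx (pred2 i0 i1) p; rewrite pair_basis => /(_ Vp) <-.
  apply: (basis_ext hx (homm_comp hs (retr_hom _ _))
    (homm_comp (retr_hom _ _) (retr_hom _ _))) => i /=.
  rewrite !retr_basis /=; have [->|ni] /= := eqVneq i i0.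
    by rewrite !retr_basis /= eqxx eq_sym (negbTE i10).
  have [->|ni1] /= := eqVneq i i1; first by rewrite !retr_basis /= i10 eqxx.
  by rewrite (homm1 hs) (homm1 (retr_hom _ _)).
have := retr_word hx (pred1 i1) p; rewrite -e1.
rewrite -/(word hx _) e; have [u' ->] := ul.
by rewrite /word_over all_cat /= eq_sym (negbTE i12) andbF.
Qed.

Lemma twisted_mem N : twisted_factor N a. Proof. by apply: sub_sgen; left. Qed.

(** The elements g^-1 b^k g of the factor have the reduced words u^-(N+2) b^k u^(N+2). *)
Lemma twisted_not_avoids N j : (j <= N.+2)%N -> ~ avoids j (twisted_factor N).
Proof.
move=> jN [L aL]; have [u' eu] := ul.
have rU : reduced (wpow u N.+2) by exact: reduced_pow.
have V2p k : twisted_factor N ((b ^+ k) ^ twister N).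
  have [s1 sM _] := sgen_subgroup [set a; b ^ twister N].
  rewrite conjXg; elim: k => [|k IH]; first by rewrite expg0.
  by rewrite expgS; apply: sM => //; apply: sub_sgen; right.
pose B := wpow [:: (i1, true)] L.+1.
have rB : reduced B by apply: reduced_pow; rewrite /reduced /= xpair_eqE eqxx.
have rBU : reduced (B ++ wpow u N.+2).
  have -> : B ++ wpow u N.+2 = wpow [:: (i1, true)] L ++ [:: (i1, true)] ++ wpow u N.+2.
    by rewrite /B wpowSr -catA.
  apply: reduced_glue => //; first by rewrite -wpowSr.
  move: rU; rewrite /wpow /= eu /reduced /= => ->.
  by rewrite /linv xpair_eqE /= eq_sym (negbTE i12).
have rUB : reduced (winv (wpow u N.+2) ++ B).
  have E : winv (wpow u N.+2) = winv (behead (wpow u N.+2)) ++ [:: (i2, false)].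
    by rewrite /wpow /= eu /=; exact: (winv_cat [:: (i2, true)]).
  rewrite E -catA; apply: (@reduced_glue _ _ [:: (i2, false)]) => //.
    by rewrite -E reduced_inv.
  have -> : reduced ([:: (i2, false)] ++ B) =
      ((i1, true) != linv (i2, false)) && reduced B by [].
  by rewrite rB /linv xpair_eqE /= (negbTE i12).
have wE : word hx (sigma (b ^+ L.+1 ^ twister N)) =
    winv (wpow u N.+2) ++ B ++ wpow u N.+2.
  have eB : weval x B = b ^+ L.+1 by rewrite weval_pow weval1.
  rewrite -[RHS](word_eval hx); last by apply: reduced_glue.
  rewrite weval_cat weval_cat weval_inv eB; congr word.
  rewrite conjgE !(hommM hs) (hommV _ hs) twister_fixed (hommX _ _ hs).
  by rewrite retr_basis /= i10.
have nL : (L <= norm hx (sigma (b ^+ L.+1 ^ twister N)))%N.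
  rewrite /norm wE !size_cat /B size_wpow /= muln1 addSn addnS ltnW // ltnS.
  by rewrite addnCA leq_addr.
have := aL _ (V2p L.+1) nL; rewrite wE => /negP; apply; apply/suffixP.
exists (winv (wpow u N.+2) ++ B ++ wpow u (N.+2 - j)); rewrite -!catA.
by rewrite [in RHS]/wpow -[in RHS]flatten_cat -nseqD subnK.
Qed.

Lemma link_distance N l (U : nat -> set (set F)) :
  U 0%N = conj_class pair_factor -> U l = conj_class (twisted_factor N) ->
  (forall i, (i < l)%N -> [/\ U i <> conj_class A, U i.+1 <> conj_class A &
     ff_simplices [set conj_class A; U i; U i.+1]]) ->
  (N.+1 < l)%N.
Proof.
move=> U0 Ul Ustep.
have loc i : (i <= l)%N -> located i.+1 (U i).
  elim: i => [_|i IH il].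
    exists pair_factor; split=> //; first exact: pair_proper; last exact: pair_avoids.
    by apply: sub_sgen; left.
  have [Ui Ui1 fs] := Ustep i il.
  by apply: (located_step (IH _) Ui Ui1 fs); exact: ltnW.
have [W [pW Wa eW aW]] := loc l (leqnn l).
have [h Wh] : exists h, W = conj_set (twisted_factor N) h by apply: conj_classP; rewrite eW.
have [v V2v vh] : conj_set (twisted_factor N) h a by rewrite -Wh.
have sV2 := proper_subgroup (twisted_proper N).
have Vh : twisted_factor N h^-1.
  refine (@factor_malnormal n F x hx i0 _ _ (proper_factor (twisted_proper N)) (@twisted_mem N) _).
  by rewrite -vh conjgK.
have V2h : twisted_factor N h by case: sV2 => _ _ /(_ _ Vh); rewrite invgK.
rewrite ltnNge; apply/negP => lN; apply: (@twisted_not_avoids N l.+1).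
  by rewrite ltnS.
by rewrite -(conj_set_in sV2 V2h) -Wh.
Qed.

End Link.

Local Close Scope group_scope.
Import Order.TTheory GRing.Theory Num.Theory.
Import numFieldNormedType.Exports.
Local Open Scope card_scope.
Local Open Scope ring_scope.

(** * The disc *)

Lemma heine_cantor (R : realType) (U V : pseudoMetricType R) (K : set U)
    (f : U -> V) (e : R) : compact K -> {within K, continuous f} -> 0 < e ->
  exists2 d : R, 0 < d &
    forall x y, K x -> K y -> ball x d y -> ball (f x) e (f y).
Proof.
move=> /compact_near_coveringP cK /subspace_continuousP cf e0.
have := cK R (0^'+) (fun d x => K x -> forall y, K y -> ball x d y ->
  ball (f x) e (f y)) _ _.
case.
  move=> x Kx; have /cvg_ballP/(_ (e / 2)) := cf x Kx.
  rewrite divr_gt0 // => /(_ isT); rewrite near_withinE => /nbhs_ballP[r /= r0 rP].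
  exists (ball x (r / 2), [set d | d < r / 2]) => /=.
    split; first by apply: nbhsx_ballx; rewrite divr_gt0.
    by apply: nbhs_right_lt; rewrite divr_gt0.
  move=> [x' d] /= [xx' dr] Kx' y Ky x'y.
  have b1 : ball (f x) (e / 2) (f x').
    by apply: rP => //; apply: le_ball xx'; rewrite ler_pdivrMr // ler_pMr // ler1n.
  have b2 : ball (f x) (e / 2) (f y).
    apply: rP => //; rewrite [r]splitr; apply: ball_triangle xx' _.
    by apply: le_ball x'y; exact: ltW.
  by rewrite [e]splitr; apply: ball_triangle b2; exact: ball_sym.
move=> d0 /= d00 H; exists (d0 / 2); first by rewrite divr_gt0.
move=> x y Kx Ky xy; apply: (H (d0 / 2)) => //=; last by rewrite divr_gt0.
rewrite /ball /= sub0r normrN gtr0_norm ?divr_gt0 //.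
by rewrite ltr_pdivrMr // ltr_pMr // ltr1n.
Qed.

Section Disc.
Variable R : realType.
Notation disc := (@unit_disc R).

Lemma disc_coord z : disc z -> `|z.1| <= 1 /\ `|z.2| <= 1.
Proof.
rewrite /unit_disc /= => D; move: (z.1) (z.2) D => u v D.
by split; rewrite ler_norml; apply/andP; split; nra.
Qed.

Lemma disc_compact : compact disc.
Proof.
apply: (@subclosed_compact _ disc (`[(-1 : R), 1] `*` `[(-1 : R), 1])).
- have -> : disc = (fun z : R * R => z.1 ^+ 2 + z.2 ^+ 2) @^-1` [set r | r <= 1] by [].
  apply: closed_comp; last exact: closed_le.
  move=> z _; under eq_fun do rewrite !expr2.
  apply: cvgD; apply: cvgM; (exact: cvg_fst || exact: cvg_snd).
- by apply: compact_setX; exact: segment_compact.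
- by move=> z /disc_coord[]; rewrite !ler_norml /= !in_itv /= => -> ->.
Qed.

Lemma disc_star z (t : R) : disc z -> 0 <= t <= 1 -> disc (t * z.1, t * z.2).
Proof.
rewrite /unit_disc /= => D /andP[t0 t1]; rewrite !exprMn -mulrDr.
have s0 : 0 <= z.1 ^+ 2 + z.2 ^+ 2 by rewrite addr_ge0 ?sqr_ge0.
by rewrite mulr_ile1 ?sqr_ge0 // expr_le1.
Qed.

End Disc.

(** * Winding of cyclically ordered labels *)

(** The step from c to c' on the 3-cycle, with values in -1, 0, 1: a cocycle on
    triples of labels that are not all distinct, by [labdiffD]. *)
Definition labdiff (c c' : 'I_3) : int :=
  match (c : nat), (c' : nat) with
  | O, S O | S O, S (S O) | S (S O), O => 1
  | S O, O | S (S O), S O | O, S (S O) => - 1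
  | _, _ => 0
  end.

Lemma labdiffD (c1 c2 c3 : 'I_3) : ~~ [&& c1 != c2, c2 != c3 & c1 != c3] ->
  labdiff c1 c2 + labdiff c2 c3 = labdiff c1 c3.
Proof.
by case: c1 c2 c3 => [[|[|[|]]] ?] // [[|[|[|]]] ?] // [[|[|[|]]] ?].
Qed.

Lemma labdiffnn c : labdiff c c = 0.
Proof. by case: c => [[|[|[|]]] ?]. Qed.

Section Winding.
Variable l : nat -> nat -> 'I_3.
Variable M : nat.
Definition winding j : int := \sum_(i < M) labdiff (l j i) (l j i.+1).

(** Two consecutive rows of a grid of labels: in each small square, cut into two
    triangles by a diagonal, the cocycle relation holds, so the windings of the
    rows differ by the contributions of the two sides. *)
Lemma windingS j :
  (forall i, (i < M)%N -> ~~ [&& l j i != l j i.+1, l j i.+1 != l j.+1 i.+1 & l j i != l j.+1 i.+1]) ->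
  (forall i, (i < M)%N -> ~~ [&& l j i != l j.+1 i, l j.+1 i != l j.+1 i.+1 & l j i != l j.+1 i.+1]) ->
  winding j + labdiff (l j M) (l j.+1 M) = labdiff (l j 0) (l j.+1 0) + winding j.+1.
Proof.
rewrite /winding; elim: M => [|k IH] h1 h2; first by rewrite !big_ord0 add0r addr0.
rewrite !big_ord_recr /= -addrA (labdiffD (h1 k _)) // -(labdiffD (h2 k _)) //.
rewrite addrA IH ?addrA // => i ik; [apply: h1|apply: h2]; exact: ltnW.
Qed.
End Winding.

Lemma missing_label (c c1 c2 c3 : 'I_3) : c1 != c -> c2 != c -> c3 != c ->
  ~~ [&& c1 != c2, c2 != c3 & c1 != c3].
Proof.
by case: c c1 c2 c3 => [[|[|[|]]] ?] // [[|[|[|]]] ?] // [[|[|[|]]] ?] // [[|[|[|]]] ?].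
Qed.

Lemma winding_two_labels (l : nat -> 'I_3) (M : nat) (c : 'I_3) :
  (forall i, (i <= M)%N -> l i != c) ->
  \sum_(i < M) labdiff (l i) (l i.+1) = labdiff (l 0%N) (l M).
Proof.
elim: M => [|k IH] h; first by rewrite big_ord0 labdiffnn.
rewrite big_ord_recr /= IH; last by move=> i ik; apply: h; exact: leqW.
by rewrite labdiffD //; apply: (missing_label (c := c)); apply: h; rewrite ?leqnSn.
Qed.

(** * A labelling lemma for triangulated discs *)

Section Rainbow.
Variables (R : realType) (m : nat) (P : scomplex 'I_m) (h : 'rV[R]_m -> R * R).
Hypothesis tri : disc_triangulation P h.
Notation disc := (@unit_disc R).

Lemma inv_small (d : R) : 0 < d -> exists M : nat, (M.+1%:R)^-1 < d.
Proof.
move=> d0; exists (Num.truncn d^-1); rewrite invf_plt ?posrE ?ltr0n //.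
exact: truncnS_gt.
Qed.

Definition segment_pt (p q : 'I_m) (s : R) : 'rV[R]_m :=
  \row_i ((1 - s) * (i == p)%:R + s * (i == q)%:R).

Lemma segment_support p q s i : segment_pt p q s ord0 i != 0 -> i = p \/ i = q.
Proof.
rewrite mxE; have [->|_] := eqVneq i p; first by left.
have [->|_] := eqVneq i q; first by right.
by rewrite !mulr0 addr0 eqxx.
Qed.

Lemma segment0 p q : segment_pt p q 0 = segment_pt p p 0.
Proof. by apply/rowP => i; rewrite !mxE !mul0r. Qed.
Lemma segment1 p q : segment_pt p q 1 = segment_pt q q 0.
Proof. by apply/rowP => i; rewrite !mxE subrr subr0 !mul0r add0r addr0. Qed.

Lemma segment_realization p q s : P [set p; q] -> 0 <= s <= 1 ->
  realization P (segment_pt p q s).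
Proof.
move=> Ppq /andP[s0 s1].
have sum1 : \sum_i segment_pt p q s ord0 i = 1.
  under eq_bigr do rewrite mxE.
  rewrite big_split /= -!big_distrr /=.
  have H (r : 'I_m) : \sum_(i < m) (i == r)%:R = 1 :> R.
    rewrite (bigD1 r) //= eqxx big1 ?addr0 // => i /negbTE ->.
    by [].
  by rewrite !H; ring.
split=> //.
  by move=> i; rewrite mxE; apply: addr_ge0; rewrite mulr_ge0 // ?subr_ge0 // ler0n.
apply: simplex_sub Ppq _ _.
  by move=> i /= /segment_support.
apply: contrapT => n0; have := oner_neq0 R; rewrite -sum1 big1 ?eqxx // => i _.
by apply/eqP; apply: contrapT => /negP ni; apply: n0; exists i.
Qed.

Lemma segment_ball p q s t d : `|s - t| < d ->
  ball (segment_pt p q s) d (segment_pt p q t).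
Proof.
move=> std; split; first exact: le_lt_trans (normr_ge0 _) std.
move=> i j; rewrite /ball /= !mxE; apply: le_lt_trans std.
have -> : (1 - s) * (j == p)%:R + s * (j == q)%:R -
   ((1 - t) * (j == p)%:R + t * (j == q)%:R) =
   (s - t) * ((j == q)%:R - (j == p)%:R) :> R by ring.
rewrite normrM ler_piMr //.
by case: (j == q); case: (j == p); rewrite ?subrr ?subr0 ?sub0r ?normrN ?normr0 ?normr1.
Qed.

(** Suppose that no simplex carries all labels.  Through the homeomorphism, the
    barycentric weights nu c of the three labels become functions on the disc,
    of sum 1, one of which vanishes at each point.  Label each point of the disc
    by some c with nu c at least 1/3: three nearby points never have three
    distinct labels.  Shrinking the boundary loop to the centre through T + 1
    homothetic copies, each sampled at M + 1 points per edge, the total winding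
    S j is constant; it is 0 at the centre and 3 on the boundary loop. *)
Lemma rainbow (lab : 'I_m -> 'I_3) (p : nat -> 'I_m) :
  (forall k, (k < 4)%N -> P [set p k; p k.+1]) -> p 4%N = p 0%N ->
  [/\ lab (p 0%N) = 0 :> nat, lab (p 1%N) = 1%N :> nat,
      lab (p 2) <> 0 :> nat & lab (p 3) = 2 :> nat]%N ->
  exists2 s, P s & forall c, exists2 i, s i & lab i = c.
Proof.
case: tri => hbij hcont [g hK gcont] Pp p40 [lab0 lab1 lab2 lab3].
apply: contrapT => nos.
have gh x : realization P x -> g (h x) = x by move=> Px; apply: hK; rewrite inE.
have [hfun _ hsurj] := hbij.
have gD y : disc y -> realization P (g y) /\ h (g y) = y.
  by move=> /hsurj[x Px <-]; rewrite gh.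
pose nu c (x : 'rV[R]_m) := \sum_(i | lab i == c) x ord0 i.
have nu_sum x : realization P x -> \sum_c nu c x = 1.
  case=> _ <- _; rewrite [RHS](partition_big lab xpredT) //=.
have nu0 x : realization P x -> exists c, nu c x = 0.
  case=> _ _ Ps; apply: contrapT => nc; apply: nos; exists (Defs.support x) => // c.
  apply: contrapT => ni; apply: nc; exists c; apply: big1 => i /eqP labi.
  by apply/eqP; apply: contrapT => /negP xi; apply: ni; exists i.
(* At most m coordinates vary by less than this bound, so each weight varies by
   less than 1/3. *)
have e0 : 0 < (3 * m.+1%:R)^-1 :> R by rewrite invr_gt0 mulr_gt0 ?ltr0n.
have [d1 d10 gunif] := heine_cantor (@disc_compact R) gcont e0.
have nu_close c y z : disc y -> disc z -> ball y d1 z ->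
    nu c (g y) < nu c (g z) + 3^-1.
  move=> Dy Dz yz; rewrite -ltrBlDl -sumrB.
  have H i : g y ord0 i - g z ord0 i <= (3 * m.+1%:R)^-1.
    apply: le_trans (ler_norm _) _; apply: ltW.
    by have [_] := gunif _ _ Dy Dz yz; apply.
  apply: le_lt_trans (_ : _ <= \sum_(i < m) (3 * m.+1%:R)^-1) _.
    rewrite [leRHS](bigID (fun i => lab i == c)) /=.
    rewrite -[leLHS]addr0 lerD ?ler_sum // sumr_ge0 // => i _; exact: ltW.
  rewrite sumr_const card_ord -[_ *+ m]mulr_natr invfM -mulrA gtr_pMr ?invr_gt0 ?ltr0n //.
  by rewrite mulrC ltr_pdivrMr ?ltr0n // mul1r ltr_nat.
pose la y : 'I_3 := odflt 0 [pick c | 3^-1 <= nu c (g y)].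
have laP y : disc y -> 3^-1 <= nu (la y) (g y).
  move=> Dy; rewrite /la; case: pickP => //= H; exfalso.
  have := nu_sum _ (gD y Dy).1.
  rewrite !big_ord_recr !big_ord0 /= add0r.
  have := H (widen_ord (leqnSn 2) (widen_ord (leqnSn 1) ord_max)).
  have := H (widen_ord (leqnSn 2) ord_max); have := H ord_max.
  move=> /negbT + /negbT + /negbT; rewrite -!ltNge.
  by move: (nu _ _) (nu _ _) (nu _ _) => u v w; clear; lra.
have la_close y1 y2 y3 : disc y1 -> disc y2 -> disc y3 ->
    ball y1 d1 y2 -> ball y1 d1 y3 ->
    ~~ [&& la y1 != la y2, la y2 != la y3 & la y1 != la y3].
  move=> D1 D2 D3 b12 b13; have [c c0] := nu0 _ (gD _ D1).1.
  have pos y : disc y -> ball y1 d1 y -> la y != c.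
    move=> Dy by1; apply/eqP => lac; have := laP y Dy; rewrite lac => cy.
    have := nu_close c _ _ Dy D1 (ball_sym by1); rewrite c0 add0r.
    by rewrite ltNge cy.
  by apply: (missing_label (c := c)); apply: pos => //; exact: ballxx.
have la_supp x : realization P x -> exists2 i, x ord0 i != 0 & la (h x) = lab i.
  move=> Px; have := laP (h x) (hfun _ Px); rewrite gh // => le3.
  apply: contrapT => ni; move: le3; rewrite /nu big1 ?leNgt ?invr_gt0 ?ltr0n //.
  move=> i /eqP labi; apply/eqP; apply: contrapT => /negP xi; apply: ni.
  by exists i.
have compP : compact (realization P : set 'rV[R]_m).
  have -> : (realization P : set 'rV[R]_m) = g @` disc.
    apply/seteqP; split=> [x Px|_ [y Dy <-]]; last exact: (gD y Dy).1.
    by exists (h x); [exact: hfun|exact: gh].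
  apply: continuous_compact => //; exact: disc_compact.
have d12 : 0 < d1 / 2 by rewrite divr_gt0.
have [d2 d20 hunif] := heine_cantor compP hcont d12.
have [M Md] := inv_small d20; have [T Td] := inv_small d12.
pose z k i := h (segment_pt (p k) (p k.+1) (i%:R / M.+1%:R)).
have unit_frac (N i : nat) : (i <= N.+1)%N -> 0 <= (i%:R / N.+1%:R : R) <= 1.
  move=> iN; rewrite divr_ge0 ?ler0n //= ler_pdivrMr ?ltr0n // mul1r.
  by rewrite ler_nat.
have frac_dist (N i j : nat) (d : R) : (N.+1%:R)^-1 < d -> (i <= j.+1)%N -> (j <= i.+1)%N ->
    `|i%:R / N.+1%:R - j%:R / N.+1%:R| < d.
  move=> Nd ij ji; rewrite -mulrBl normrM [X in _ * X]gtr0_norm ?invr_gt0 ?ltr0n //.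
  apply: le_lt_trans Nd; rewrite ler_piMl ?invr_ge0 ?ler0n //.
  have h1 : i%:R <= j%:R + 1 :> R by rewrite natr1 ler_nat.
  have h2 : j%:R <= i%:R + 1 :> R by rewrite natr1 ler_nat.
  rewrite ler_norml; apply/andP; move: h1 h2.
  by move: (i%:R) (j%:R) => u v; clear; split; lra.
have zD k i : (k < 4)%N -> (i <= M.+1)%N -> disc (z k i).
  by move=> k4 iM; apply: hfun; apply: segment_realization; [exact: Pp|exact: unit_frac].
pose Q k j i : R * R :=
  (j%:R / T.+1%:R * (z k i).1, j%:R / T.+1%:R * (z k i).2).
have QD k j i : (k < 4)%N -> (j <= T.+1)%N -> (i <= M.+1)%N -> disc (Q k j i).
  by move=> k4 jT iM; apply: disc_star; [exact: zD|exact: unit_frac].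
have Qball k j i j' i' : (k < 4)%N -> (j <= T.+1)%N -> (j' <= T.+1)%N ->
    (i <= M.+1)%N -> (i' <= M.+1)%N ->
    (i <= i'.+1)%N -> (i' <= i.+1)%N -> (j <= j'.+1)%N -> (j' <= j.+1)%N ->
    ball (Q k j i) d1 (Q k j' i').
  move=> k4 jT j'T iM i'M ii' i'i jj' j'j.
  have [z1 z2] : ball (z k i) (d1 / 2) (z k i').
    apply: hunif; try (apply: segment_realization; [exact: Pp|exact: unit_frac]).
    by apply: segment_ball; exact: frac_dist.
  have [c1 c2] := disc_coord (zD k i' k4 i'M).
  have tt := frac_dist T j j' _ Td jj' j'j.
  have t01 := unit_frac T j jT.
  have H (t t' u v : R) : 0 <= t <= 1 -> `|t - t'| < d1 / 2 -> `|u - v| < d1 / 2 ->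
      `|v| <= 1 -> `|t * u - t' * v| < d1.
    move=> /andP[t0 t1] tt' uv v1.
    have -> : t * u - t' * v = t * (u - v) + (t - t') * v by ring.
    apply: le_lt_trans (ler_normD _ _) _; rewrite [d1]splitr; apply: ler_ltD.
      rewrite normrM ger0_norm // -[leRHS]mul1r ler_pM // ltW //.
    apply: le_lt_trans tt'; rewrite normrM ler_piMr //.
  by split; apply: H.
pose l k j i := la (Q k j i).
pose S j := \sum_(k < 4) winding (l k) M.+1 j.
have glue k j : Q k j M.+1 = Q k.+1 j 0%N.
  by rewrite /Q /z divff ?pnatr_eq0 // mul0r segment1 segment0.
have Sstep j : (j < T.+1)%N -> S j = S j.+1.
  move=> jT; pose V k := labdiff (l k j 0%N) (l k j.+1 0%N).
  have W k : (k < 4)%N -> winding (l k) M.+1 j + V k.+1 = V k + winding (l k) M.+1 j.+1.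
    move=> k4; rewrite -windingS /V /l -?glue // => i iM; apply: la_close;
     (apply: QD || apply: Qball); move: k4 jT iM; clear; lia.
  have V40 : V 4%N = V 0%N by rewrite /V /l /Q /z !mul0r !segment0 p40.
  have := W 0%N isT; have := W 1%N isT; have := W 2%N isT; have := W 3%N isT.
  rewrite /S !big_ord_recr !big_ord0 /= V40. lia.
have S0 : S 0%N = 0.
  rewrite /S big1 // => k _; rewrite /winding big1 // => i _.
  by rewrite /l /Q !mul0r labdiffnn.
have ST : S T.+1 = 0.
  suff H j : (j <= T.+1)%N -> S j = 0 by exact: H.
  by elim: j => // j IH jT; rewrite -Sstep // IH // ltnW.
have lT k i : l k T.+1 i = la (z k i).
  by rewrite /l /Q divff ?pnatr_eq0 // !mul1r -surjective_pairing.
have end0 k : (k < 4)%N -> la (z k 0%N) = lab (p k).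
  move=> k4; rewrite /z mul0r segment0.
  have [|i /segment_support ip ->] := la_supp (segment_pt (p k) (p k) 0).
    rewrite -(segment0 (p k) (p k.+1)); apply: segment_realization; first exact: Pp.
    by rewrite lexx ler01.
  by case: ip => ->.
have end1 k : (k < 4)%N -> la (z k M.+1) = lab (p k.+1).
  move=> k4; rewrite /z divff ?pnatr_eq0 // segment1.
  have [|i /segment_support ip ->] := la_supp (segment_pt (p k.+1) (p k.+1) 0).
    rewrite -(segment1 (p k) (p k.+1)); apply: segment_realization; first exact: Pp.
    by rewrite lexx ler01.
  by case: ip => ->.
(* Along an edge the labels of points are among those of its two endpoints, so
   the winding depends on the endpoints only. *)
have WT k c : (k < 4)%N -> lab (p k) != c -> lab (p k.+1) != c ->
    winding (l k) M.+1 T.+1 = labdiff (lab (p k)) (lab (p k.+1)).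
  move=> k4 c1 c2; rewrite /winding.
  under eq_bigr do rewrite !lT.
  rewrite (winding_two_labels (l := fun i => la (z k i)) (c := c)) ?end0 ?end1 // => i iM.
  have [|v /segment_support vp ->] := la_supp (segment_pt (p k) (p k.+1) (i%:R / M.+1%:R)).
    by apply: segment_realization; [exact: Pp|exact: unit_frac].
  by case: vp => ->.
have L0 : lab (p 0%N) = Ordinal (isT : 0 < 3)%N by exact: val_inj.
have L1 : lab (p 1%N) = Ordinal (isT : 1 < 3)%N by exact: val_inj.
have L3 : lab (p 3%N) = Ordinal (isT : 2 < 3)%N by exact: val_inj.
have L4 : lab (p 4%N) = Ordinal (isT : 0 < 3)%N by rewrite p40.
move: ST; rewrite /S !big_ord_recr !big_ord0 /=.
rewrite (WT 0%N (Ordinal (isT : 2 < 3)%N)) ?(WT 1%N (lab (p 0%N)))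
  ?(WT 2%N (lab (p 0%N))) ?(WT 3%N (Ordinal (isT : 1 < 3)%N)) ?L0 ?L1 ?L3 ?L4 //.
- by case: (lab (p 2%N)) lab2 => [[|[|[|]]] ?].
- by case: (lab (p 2%N)) lab2 => [[|[|[|]]] ?].
- by case: (lab (p 2%N)) lab2 => [[|[|[|]]] ?].
Qed.

End Rainbow.

(** * Paths around a set of vertices of a triangulated disc *)

Section LinkPath.
Variables (R : realType) (m : nat) (P : scomplex 'I_m) (h : 'rV[R]_m -> R * R).
Hypothesis tri : disc_triangulation P h.

Lemma card_triple (T : eqType) (a b c : T) : a != b -> b != c -> a != c ->
  [set a; b; c] #= `I_3.
Proof.
move=> ab bc ac.
have -> : [set a; b; c] = nth a [:: a; b; c] @` `I_3.
  apply/seteqP; split=> [_ [[]|] ->|_ [[|[|[|//]]] _ <-]] /=.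
  - by exists 0%N.
  - by exists 1%N.
  - by exists 2%N.
  - by left; left.
  - by left; right.
  - by right.
apply: inj_card_eq => i j; rewrite !inE /= => i3 j3 /eqP.
have u : uniq [:: a; b; c] by rewrite /= !inE negb_or ab ac bc.
by rewrite nth_uniq // => /eqP.
Qed.

Lemma leq_num_triangles (l : nat) (t : nat -> set 'I_m) :
  (forall i, (i < l)%N -> dim_simplices P 2 (t i)) ->
  (forall i j, (i < j)%N -> (j < l)%N -> t i <> t j) ->
  (l <= num_triangles P)%N.
Proof.
move=> tP tinj.
have fin : finite_set (dim_simplices P 2).
  apply: (@sub_finite_set _ _ (range (fun A : {set 'I_m} => [set i | i \in A]))).
    move=> s _; exists [set i : 'I_m | `[< s i >] ]%SET => //.
    by apply/seteqP; split=> i /=; rewrite inE => /asboolP.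
  by apply: finite_image; exact: finite_finset.
rewrite /num_triangles -(size_iota 0 l) -(size_map t).
apply: uniq_leq_size.
  rewrite map_inj_in_uniq ?iota_uniq // => i j.
  rewrite !mem_iota !add0n /= => il jl e.
  case: (ltngtP i j) => // ij; first by have := tinj _ _ ij jl.
  by have := tinj _ _ ij il; rewrite e.
move=> _ /mapP[i + ->]; rewrite mem_iota add0n /= => il.
suff : t i \in fset_set (dim_simplices P 2) by [].
by rewrite in_fset_set // inE; exact: tP.
Qed.

(** If p 1 and p 3 were not connected in the graph E, the labels 0 on S, 1 on the
    component of p 1 and 2 elsewhere would contradict [rainbow]: a simplex with
    vertices labelled 0, 1 and 2 contains an edge of E leaving the component. *)
Lemma link_path (S : pred 'I_m) (p : nat -> 'I_m) :
  (forall k, (k < 4)%N -> P [set p k; p k.+1]) -> p 4%N = p 0%N ->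
  S (p 0%N) -> ~~ S (p 1%N) -> ~~ S (p 2%N) -> ~~ S (p 3%N) ->
  exists l (y : nat -> 'I_m), [/\ y 0%N = p 1%N, y l = p 3%N,
    (l <= num_triangles P)%N & forall i, (i < l)%N ->
      [/\ ~~ S (y i), ~~ S (y i.+1) &
          exists2 s, S s & P [set s; y i; y i.+1]]].
Proof.
move=> Pp p40 S0 S1 S2 S3.
pose E u w := [&& ~~ S u, ~~ S w & `[< exists2 s, S s & P [set s; u; w] >]].
have [|nc] := boolP (connect E (p 1%N) (p 3%N)); last first.
  exfalso.
  pose lab i : 'I_3 := if S i then Ordinal (isT : 0 < 3)%N else
    if connect E (p 1%N) i then Ordinal (isT : 1 < 3)%N
    else Ordinal (isT : 2 < 3)%N.
  have [|s Ps sall] := rainbow tri (lab := lab) Pp p40.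
    rewrite /lab S0 (negbTE S1) (negbTE S2) (negbTE S3) connect0 (negbTE nc).
    by split=> //; case: ifP.
  have [a sa] := sall (Ordinal (isT : 0 < 3)%N).
  have [b sb] := sall (Ordinal (isT : 1 < 3)%N).
  have [c sc] := sall (Ordinal (isT : 2 < 3)%N).
  rewrite /lab; case Sc: (S c) => //; case cc: (connect _ _ _) => // _.
  case Sb: (S b) => //; case cb: (connect _ _ _) => // _.
  case Sa: (S a); [move=> _|by case: ifP].
  move: cc; rewrite (connect_trans cb) // connect1 // /E Sb Sc /=.
  apply/asboolP; exists a => //; apply: simplex_sub Ps _ _.
    by move=> _ [[]|] ->.
  by exists a; left; left.
case/connectP => q0 pq0 lq0; case/shortenP: pq0 lq0 => q pq uq _ lq.
pose y := nth (p 1%N) (p 1%N :: q).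
have yE i : (i < size q)%N -> E (y i) (y i.+1) by move/(pathP (p 1%N)): pq; apply.
have yinj i j : (i <= size q)%N -> (j <= size q)%N -> y i = y j -> i = j.
  by move=> il jl /eqP; rewrite nth_uniq // => /eqP.
exists (size q), y; split=> //.
- by rewrite lq /y nth_last.
- pose t i : set 'I_m := if pselect (exists2 s, S s & P [set s; y i; y i.+1])
    is left H then [set s2val (cid2 H); y i; y i.+1] else set0.
  have tP i : (i < size q)%N -> exists2 s, S s &
      P [set s; y i; y i.+1] /\ t i = [set s; y i; y i.+1].
    move=> il; rewrite /t; case: pselect => [H|].
      by case: (cid2 H) => s Ss Ps; exists s.
    by case/and3P: (yE i il) => _ _ /asboolP.
  (* The two vertices of t i outside S determine i, as the path is simple. *)
  apply: (@leq_num_triangles _ t) => [i il|i j ij jl].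
    have [s Ss [Ps ->]] := tP i il; have /and3P[n1 n2 _] := yE i il.
    split=> //; apply: card_triple.
    + by apply: contraNneq n1 => <-.
    + by apply/eqP => /yinj; lia.
    + by apply: contraNneq n2 => <-.
  have [s Ss [_ ->]] := tP i (ltn_trans ij jl).
  have [s' Ss' [_ ->]] := tP j jl; have /and3P[n1 n2 _] := yE j jl.
  move=> e.
  have H k : ~~ S (y k) -> (k <= size q)%N -> [set s'; y j; y j.+1] (y k) ->
      k = i \/ k = i.+1.
    move=> nk kl; rewrite -e => -[[]|].
    + by move=> es; rewrite es Ss in nk.
    + by move/yinj => ->; [left|by []|lia].
    + by move/yinj => ->; [right|by []|lia].
  have := H j n1 (ltnW jl) (or_introl (or_intror erefl)).
  have := H j.+1 n2 jl (or_intror erefl).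
  by move: ij; clear; lia.
- move=> i /yE/and3P[n1 n2 /asboolP H]; split=> //.
Qed.

(** Vertices of the boundary complex correspond to those of the loop, as the
    bijection on simplices restricts to singletons; an edge of the loop lifts to
    a boundary simplex containing the two lifted vertices.  The index is
    extended periodically to natural numbers. *)
Lemma boundary_vertices (V : Type) (f : 'I_m -> V) (c : 'I_4 -> V) :
  set_bij (boundary_simplices P h) (loop_simplices c) (fun s => f @` s) ->
  exists p : nat -> 'I_m,
  [/\ forall k, (k < 4)%N -> P [set p k; p k.+1], p 4%N = p 0%N &
      forall i : 'I_4, f (p i) = c i].
Proof.
move=> [_ binj bsurj].
have sub (s t : set 'I_m) : boundary_simplices P h s -> t `<=` s -> t !=set0 ->
    boundary_simplices P h t.
  move=> [Ps hs] ts t0; split; first exact: simplex_sub Ps ts t0.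
  apply: subset_trans hs; apply: image_subset => x [x0 x1 xt]; split=> //.
  exact: subset_trans xt ts.
have uniqv u u' : boundary_simplices P h [set u] ->
    boundary_simplices P h [set u'] -> f u = f u' -> u = u'.
  move=> bu bu' fu; have : [set u] = [set u'].
    by apply: binj; rewrite ?inE // !image_set1 fu.
  by move=> e; have : [set u] u by []; rewrite e.
have edge i : exists u w, [/\ boundary_simplices P h [set u],
    boundary_simplices P h [set w], P [set u; w], f u = c i & f w = c (ordS i)].
  have [|s bs fs] := bsurj [set c i; c (ordS i)]; first by exists i; right.
  have [u su fu] : (f @` s) (c i) by rewrite fs; left.
  have [w sw fw] : (f @` s) (c (ordS i)) by rewrite fs; right.
  exists u, w; split=> //.
  - by apply: (sub s) => // [_ ->|] //; exists u.
  - by apply: (sub s) => // [_ ->|] //; exists w.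
  - by case: (sub s [set u; w]) => // [_ [->|->] //|]; exists u; left.
have [v vP] : exists v : 'I_4 -> 'I_m, forall i,
    boundary_simplices P h [set v i] /\ f (v i) = c i.
  have H i : exists u, boundary_simplices P h [set u] /\ f u = c i.
    by have [u [w [? ? ? ? ?]]] := edge i; exists u.
  by exists (fun i => sval (cid (H i))) => i; exact: (svalP (cid (H i))).
have vE i : P [set v i; v (ordS i)].
  have [u [w [bu bw Puw fu fw]]] := edge i.
  have <- : u = v i by apply: uniqv; rewrite ?(vP i).2 //; exact: (vP i).1.
  have <- // : w = v (ordS i).
  by apply: uniqv; rewrite ?(vP (ordS i)).2 //; exact: (vP (ordS i)).1.
exists (fun k => v (inord (k %% 4))); split.
- move=> k k4.
  have <- : ordS (inord (k %% 4)) = inord (k.+1 %% 4) :> 'I_4; last exact: vE.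
  by apply: val_inj; rewrite /= !inordK ?ltn_mod // [(k %% 4)%N]modn_small.
- by [].
- by move=> i; rewrite modn_small // inord_val (vP i).2.
Qed.

End LinkPath.

(** * Loops with large fillings *)

Lemma ff_edge (F : groupType) (A B : set F) :
  proper_free_factor A -> proper_free_factor B -> sub_up_to_conj A B ->
  ff_simplices [set conj_class A; conj_class B].
Proof.
move=> pA pB AB; exists 2%N, (fun i => if i is 0%N then A else B); split=> //.
- by case.
- by case=> [|[]].
- apply/seteqP; split=> [_ [->|->]|_ [[|[|//]] _ <-]].
  + by exists 0%N.
  + by exists 1%N.
  + by left.
  + by right.
Qed.

Lemma card_pair_le (T : Type) (a b : T) : [set a; b] #<= `I_2.
Proof.
have -> : [set a; b] = (fun i => if i is 0%N then a else b) @` `I_2.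
  apply/seteqP; split=> [_ [->|->]|_ [[|[|//]] _ <-]].
  + by exists 0%N.
  + by exists 1%N.
  + by left.
  + by right.
exact: card_image_le.
Qed.

(** The retraction killing x i is trivial on every conjugate of <x i>. *)
Lemma conj_class_neq (n : nat) (F : groupType) (x : 'I_n -> F)
    (hx : free_basis x) i (W : set F) w : W w ->
  retr hx (predC1 i) w <> (1%g : F) ->
  conj_class (sgen [set x i]) <> conj_class W.
Proof.
move=> Ww rw /esym/conj_classP[g eW]; apply: rw.
have hr := retr_hom hx (predC1 i); rewrite eW in Ww.
case: Ww => v; move: v.
have K : sgen [set x i] `<=` [set z | retr hx (predC1 i) z = 1%g].
  apply: sgen_min; last by move=> _ -> /=; rewrite retr_basis /= eqxx.
  by apply: equalizer_subgroup => //; exact: homm_cst.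
by move=> v /K /= rv <-; rewrite (hommM hr) (hommM hr) rv mul1g (hommV _ hr) mulVg.
Qed.

Theorem theorem1 (R : realType) (n : nat) (hn : (4 <= n)%N)
    (F : groupType) (x : 'I_n -> F) (hx : free_basis x) :
  let C := (2 * n - 4)%N in
  exists c : nat -> 'I_4 -> set (set F),
    (forall N : nat, comb_loop (skeleton (free_factor_complex F) 1) (c N)
                     /\ injective (c N)) /\
    forall (N m : nat) (P : scomplex 'I_m) (h : 'rV[R]_m -> R * R)
           (f : 'I_m -> set (set F)),
      disc_triangulation P h ->
      simplicial_map P (skeleton (free_factor_complex F) 2) f ->
      set_bij (boundary_simplices P h) (loop_simplices (c N))
              (fun s => f @` s) ->
      (N%:R - 2 * C%:R) / 3 <= (num_triangles P)%:R :> R.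
Proof.
move=> C.
pose i0 : 'I_n := Ordinal (leq_trans (isT : 0 < 4)%N hn).
pose i1 : 'I_n := Ordinal (leq_trans (isT : 1 < 4)%N hn).
pose i2 : 'I_n := Ordinal (leq_trans (isT : 2 < 4)%N hn).
have i10 : i1 != i0 by []. have i20 : i2 != i0 by []. have i12 : i1 != i2 by [].
have [u' [uJ ru lu uturn]] := full_word i10 i20 i12.
pose u := (i2, true) :: u'; rewrite -/u in uJ ru uturn.
have uu : reduced (u ++ u).
  by rewrite /reduced /u /= cat_path lu; move: ru; rewrite /reduced /u /= => ->.
have ul : exists u', u = (i2, true) :: u' by exists u'.
pose A := sgen [set x i0]; pose B := sgen [set x i1].
pose W1 := pair_factor x i0 i1; pose W2 := twisted_factor x i0 i1 u.
have pA : proper_free_factor A by apply: (basis_elt_proper hx (j := i1)).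
have pB : proper_free_factor B by apply: (basis_elt_proper hx (j := i0)).
have pW1 : proper_free_factor W1 by exact: (pair_proper hx i20 i12).
have pW2 N : proper_free_factor (W2 N) by exact: (twisted_proper hx i10 i20 i12 uJ).
have dist := link_distance hx i10 i20 i12 uJ uu uturn ul.
have AW1 : sub_up_to_conj A W1.
  exists 1%g; rewrite conj_set1; apply: sgen_min; first exact: sgen_subgroup.
  by move=> _ ->; apply: sub_sgen; left.
have BW1 : sub_up_to_conj B W1.
  exists 1%g; rewrite conj_set1; apply: sgen_min; first exact: sgen_subgroup.
  by move=> _ ->; apply: sub_sgen; right.
have AW2 N : sub_up_to_conj A (W2 N).
  exists 1%g; rewrite conj_set1; apply: sgen_min; first exact: sgen_subgroup.
  by move=> _ ->; apply: sub_sgen; left.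
have BW2 N : sub_up_to_conj B (W2 N).
  exists (twister x u N)^-1%g; apply: sgen_min; first exact/conj_subgroup/sgen_subgroup.
  move=> _ ->; exists (x i1 ^ twister x u N)%g; last exact: conjgK.
  by apply: sub_sgen; right.
pose c N (i : 'I_4) : set (set F) := nth set0
  [:: conj_class A; conj_class W1; conj_class B; conj_class (W2 N)] i.
have W1B : W1 (x i1) by apply: sub_sgen; right.
have W1A : W1 (x i0) by apply: sub_sgen; left.
have W2A N : W2 N (x i0) by apply: sub_sgen; left.
have nA W w : W w -> retr hx (predC1 i0) w <> 1%g -> conj_class A <> conj_class W.
  by move=> Ww; exact: conj_class_neq.
have nB W w : W w -> retr hx (predC1 i1) w <> 1%g -> conj_class B <> conj_class W.
  by move=> Ww; exact: conj_class_neq.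
have rne i j : i != j -> retr hx (predC1 i) (x j) <> 1%g.
  by move=> ij; rewrite retr_basis /= eq_sym ij; exact: basis_neq1.
have AnW1 : conj_class A <> conj_class W1 by apply: (nA _ _ W1B); exact: rne.
have AnB : conj_class A <> conj_class B.
  by apply: (nA _ (x i1)); [exact: sub_sgen|exact: rne].
have AnW2 N : conj_class A <> conj_class (W2 N).
  apply: (nA _ (x i1 ^ twister x u N)%g); first by apply: sub_sgen; right.
  have hs := retr_hom hx (predC1 i0).
  rewrite (hommM hs) (hommM hs) (hommV _ hs) (twister_fixed hx uJ) retr_basis /=.
  rewrite -conjgE => /eqP; rewrite conjg_eq1 => /eqP; exact: basis_neq1.
have BnW1 : conj_class B <> conj_class W1 by apply: (nB _ _ W1A); exact: rne.
have BnW2 N : conj_class B <> conj_class (W2 N).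
  by apply: (nB _ _ (W2A N)); exact: rne.
(* A path of length 0 in the link would contradict the distance bound. *)
have W1nW2 N : conj_class W1 <> conj_class (W2 N).
  move=> e; suff: (N.+1 < 0)%N by [].
  by apply: (dist N 0%N (fun=> conj_class W1)).
exists c; split.
  move=> N; split.
    case=> [[|[|[|[|//]]]] i4]; split; rewrite ?card_pair_le // /c /=.
    - exact: ff_edge.
    - by rewrite setUC; exact: ff_edge.
    - exact: ff_edge.
    - by rewrite setUC; exact: ff_edge.
  move=> [i i4] [j j4]; rewrite /c /= => e; apply: val_inj => /=; move: i j i4 j4 e.
  move=> [|[|[|[|//]]]] [|[|[|[|//]]]] _ _ //= e; exfalso;
    first [exact: AnW1 e|exact: AnB e|exact: AnW2 e|exact: AnW1 (esym e)
      |exact: AnB (esym e)|exact: AnW2 (esym e)|exact: BnW1 e|exact: BnW2 e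
      |exact: BnW1 (esym e)|exact: BnW2 (esym e)|exact: W1nW2 e
      |exact: W1nW2 (esym e)].
move=> N m P h f tri fP /boundary_vertices[p [Pp p40 fp]].
pose S i := `[< f i = conj_class A >].
have fp0 : f (p 0%N) = conj_class A := fp (Ordinal (isT : 0 < 4)%N).
have fp1 : f (p 1%N) = conj_class W1 := fp (Ordinal (isT : 1 < 4)%N).
have fp2 : f (p 2%N) = conj_class B := fp (Ordinal (isT : 2 < 4)%N).
have fp3 : f (p 3%N) = conj_class (W2 N) := fp (Ordinal (isT : 3 < 4)%N).
have [||||l [y [y0 yl lP step]]] := link_path tri (S := S) Pp p40.
- exact/asboolP.
- by apply/asboolP; rewrite fp1 => /esym.
- by apply/asboolP; rewrite fp2 => /esym.
- by apply/asboolP; rewrite fp3 => /esym; exact: AnW2.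
have Nl : (N.+1 < l)%N.
  apply: (dist N l (fun i => f (y i))); rewrite /= ?y0 ?yl //.
  move=> i /step[/asboolP S1 /asboolP S2 [s /asboolP Ss /fP[fs _]]]; split=> //.
  move: fs; rewrite -Ss; congr ff_simplices; apply/seteqP; split.
    by move=> _ [v [[->|->]|->] <-]; [left; left|left; right|right].
  by move=> _ [[->|->]|->]; [exists s|exists (y i)|exists (y i.+1)] => //;
    [left; left|left; right|right].
have NT : N%:R <= (num_triangles P)%:R :> R.
  by rewrite ler_nat; apply: leq_trans lP; apply: ltnW; exact: ltnW.
have C0 : 0 <= C%:R :> R by [].
have N0 : 0 <= N%:R :> R by [].
move: NT C0 N0; move: (N%:R) (C%:R) ((num_triangles P)%:R) => a b t; clear; lra.
Qed.
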